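(* Let $(H_t)_{t>0}$ and $(P_t)_{t>0}$ be the heat and Poisson semigroups on $\mathbb R^n$. For $0<\alpha<1/2$ the following pairs of subspaces of $L^\infty(\mathbb R^n)$ coincide with equivalent norms: (i) $\ell_\alpha(\mathcal P)\simeq\mathcal L_\alpha(\mathcal P)$; (ii) $\ell_\alpha(\mathcal H)\simeq\mathcal L_\alpha(\mathcal H)$.
   Context: Let $\Delta=-\sum_{i=1}^n\partial^2/\partial x_i^2$ on $\mathbb R^n$. The heat semigroup $\mathcal H=(H_t)_{t>0}$, $H_t=e^{-t\Delta}$, is convolution with $h_t(x)=(4\pi t)^{-n/2}e^{-|x|^2/(4t)}$; the Poisson semigroup $\mathcal P=(P_t)_{t>0}$, $P_t=e^{-t\sqrt\Delta}$, is convolution with $p_t(x)=c_nt(t^2+|x|^2)^{-(n+1)/2}$, $c_n=\Gamma(\frac{n+1}2)\pi^{-(n+1)/2}$. For $\mathcal T=(T_t)_{t>0}$ equal to $\mathcal H$ or $\mathcal P$ and $0<\alpha<1$, $\ell_\alpha(\mathcal T)$ and $\mathcal L_\alpha(\mathcal T)$ are the spaces of $f\in L^\infty(\mathbb R^n)$ for which, respectively, the following norms are finite: $$\|f\|_{\ell_\alpha(\mathcal T)}=\|f\|_\infty+\sup_{t>0}\frac1{t^\alpha}\left\|T_t|f|^2-|T_tf|^2\right\|_\infty^{1/2},$$ $$\|f\|_{\mathcal L_\alpha(\mathcal T)}=\|f\|_\infty+\sup_{t>0}\frac1{t^\alpha}\left\|T_t|f-T_tf|^2\right\|_\infty^{1/2}.$$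 Equivalence of norms means two-sided bounds with positive constants not depending on $f$. *)

(* Defs.v *)
From HB Require Import structures.
From mathcomp Require Import all_boot all_order all_algebra.
From mathcomp Require Import complex.
From mathcomp Require Import all_classical all_reals all_analysis.

Set Implicit Arguments.
Unset Strict Implicit.
Unset Printing Implicit Defensive.

Import Order.TTheory GRing.Theory Num.Theory.
Import numFieldNormedType.Exports.

Local Open Scope classical_set_scope.
Local Open Scope ring_scope.

(** Points of R^n are tuples [n.-tuple R], with the product of the Borel
    sigma-algebras. *)

Section lebesgue_cons.
Context (R : realType) (n : nat).
Variable mu : {sigma_finite_measure set (n.-tuple R) -> \bar R}.

Definition cons_pair (p : measurableTypeR R * n.-tuple R) : n.+1.-tuple R :=
  [tuple of p.1 :: p.2].

Lemma measurable_cons_pair : measurable_fun [set: measurableTypeR R * n.-tuple R] cons_pair.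
Proof. exact: measurable_cons. Qed.

Definition lebesgue_cons : set (n.+1.-tuple R) -> \bar R :=
  pushforward (@lebesgue_measure R \x mu)%E cons_pair.

Let lebesgue_cons0 : lebesgue_cons set0 = 0%E.
Proof. by rewrite /lebesgue_cons /pushforward preimage_set0 measure0. Qed.

Let lebesgue_cons_ge0 A : (0 <= lebesgue_cons A)%E.
Proof. by rewrite /lebesgue_cons /pushforward; exact: measure_ge0. Qed.

Let measurable_preimage (A : set (n.+1.-tuple R)) : measurable A ->
  measurable (cons_pair @^-1` A).
Proof.
by move=> mA; rewrite -[X in measurable X]setTI; exact: measurable_cons_pair.
Qed.

Let lebesgue_cons_sigma_additive : semi_sigma_additive lebesgue_cons.
Proof.
move=> F mF tF mUF; rewrite /lebesgue_cons /pushforward preimage_bigcup.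
apply: measure_semi_sigma_additive.
- by move=> k; exact: measurable_preimage.
- apply/trivIsetP => /= i j _ _ ij; rewrite -preimage_setI.
  by move/trivIsetP : tF => /(_ _ _ _ _ ij) ->//; rewrite preimage_set0.
- by rewrite -preimage_bigcup; exact: measurable_preimage.
Qed.

HB.instance Definition _ := isMeasure.Build _ _ _ lebesgue_cons
  lebesgue_cons0 lebesgue_cons_ge0 lebesgue_cons_sigma_additive.

Let uncons (x : n.+1.-tuple R) : measurableTypeR R * n.-tuple R :=
  (thead x, [tuple of behead x]).

Let measurable_uncons : measurable_fun [set: n.+1.-tuple R] uncons.
Proof.
apply/measurable_fun_pairP; split; first exact: measurable_tnth.
exact: measurable_behead.
Qed.

Let cons_pairK : cancel cons_pair uncons.
Proof. by case=> a s; congr pair; apply/val_inj. Qed.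

Let lebesgue_cons_sigma_finite : sigma_finite setT lebesgue_cons.
Proof.
have /sigma_finiteP[F [TF ndF Foo]] := sigma_finiteT (@lebesgue_measure R).
have /sigma_finiteP[G [TG ndG Goo]] := sigma_finiteT mu.
exists (fun k => uncons @^-1` (F k `*` G k)).
  rewrite -preimage_bigcup (_ : \bigcup_k _ = setT) ?preimage_setT//.
  rewrite -subTset => -[x y] _.
  have [k _ Fkx] : (\bigcup_k F k) x by rewrite -TF.
  have [l _ Gly] : (\bigcup_k G k) y by rewrite -TG.
  exists (maxn k l) => //; split.
  - by move: x Fkx; exact/subsetPset/ndF/leq_maxl.
  - by move: y Gly; exact/subsetPset/ndG/leq_maxr.
move=> k; have [mF Fk] := Foo k; have [mG Gk] := Goo k; split.
  rewrite -[X in measurable X]setTI.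
  by apply: measurable_uncons => //; exact: measurableX.
rewrite /lebesgue_cons /pushforward -comp_preimage.
rewrite (_ : uncons \o cons_pair = id); last first.
  by apply/funext => p /=; rewrite cons_pairK.
by rewrite preimage_id product_measure1E// lte_mul_pinfty// ge0_fin_numE.
Qed.

HB.instance Definition _ := Measure_isSigmaFinite.Build _ _ _ lebesgue_cons
  lebesgue_cons_sigma_finite.

End lebesgue_cons.

(** Lebesgue measure on R^n, as the n-fold product measure. *)
Fixpoint lebesgue_tuple (R : realType) (n : nat) :
    {sigma_finite_measure set (n.-tuple R) -> \bar R} :=
  match n with
  | 0 => \d_([tuple] : 0.-tuple R)
  | m.+1 => lebesgue_cons (lebesgue_tuple R m)
  end.

Lemma lebesgue_tuple_box (R : realType) (n : nat) (A : 'I_n -> set R) :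
  (forall i, measurable (A i)) ->
  lebesgue_tuple R n [set x | forall i, A i (tnth x i)] =
  (\prod_(i < n) lebesgue_measure (A i))%E.
Proof.
elim: n A => [|n IH] A mA.
  rewrite big_ord0 /= diracE mem_set//.
  by case.
rewrite big_ord_recl -IH//= /lebesgue_cons /pushforward.
rewrite -product_measure1E//; last first.
  rewrite (_ : [set x | _] =
    \big[setI/setT]_(i < n) ((@tnth n R)^~ i @^-1` A (lift ord0 i))).
    apply: bigsetI_measurable => i _; rewrite -[X in measurable X]setTI.
    exact: measurable_tnth.
  apply/seteqP; split=> x /=; rewrite -bigcap_seq/=.
    by move=> h i _; exact: h.
  by move=> h i; apply: h => /=; rewrite mem_index_enum.
  exact: mA.
set B := (X in _ = product_measure1 _ _ X).
rewrite (_ : cons_pair (n:=n) @^-1` _ = B)//.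
apply/seteqP; split => -[a s] /=.
  move=> h; split; first exact: (h ord0).
  by move=> i; have := h (lift ord0 i); rewrite tnthS//.
move=> [h0 h] i; case: (unliftP ord0 i) => [j ->|->//].
by have := h j; rewrite [X in _ -> _ X]tnthS.
Qed.

Section semigroups.
Context (R : realType) (n : nat).
Local Notation Rn := (n.-tuple R).
Local Notation leb := (lebesgue_tuple R n).

Definition tuple_sub (x y : Rn) : Rn := [tuple tnth x i - tnth y i | i < n].

Definition sqnorm (x : Rn) : R := \sum_(i < n) tnth x i ^+ 2.

Definition Gamma (s : R) : R :=
  \int[lebesgue_measure]_(x in `]0, +oo[) (x `^ (s - 1) * expR (- x)).

Definition heat_kernel (t : R) (x : Rn) : R :=
  (4 * pi * t) `^ (- (n%:R / 2)) * expR (- (sqnorm x / (4 * t))).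

Definition poisson_kernel (t : R) (x : Rn) : R :=
  Gamma (n.+1%:R / 2) * pi `^ (- (n.+1%:R / 2)) *
  (t * (t ^+ 2 + sqnorm x) `^ (- (n.+1%:R / 2))).

(** The library has no integral of complex-valued functions: the integral is
    taken on real and imaginary parts. *)
Definition convolution (k : Rn -> R) (f : Rn -> R[i]) (x : Rn) : R[i] :=
  Complex (\int[leb]_y (k (tuple_sub x y) * complex.Re (f y)))
          (\int[leb]_y (k (tuple_sub x y) * complex.Im (f y))).

Definition heat (t : R) : (Rn -> R[i]) -> (Rn -> R[i]) :=
  convolution (heat_kernel t).

Definition poisson (t : R) : (Rn -> R[i]) -> (Rn -> R[i]) :=
  convolution (poisson_kernel t).

Definition Linfty_norm (f : Rn -> R[i]) : \bar R :=
  ('N[leb]_+oo [ (fun x => (Normc.normc (f x))%:E) ])%E.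

(** Elements of L^infty are represented by functions rather than by
    almost-everywhere classes; all the norms below depend only on the class. *)
Definition Linfty : set (Rn -> R[i]) :=
  [set f | [/\ measurable_fun setT (fun x => complex.Re (f x)),
               measurable_fun setT (fun x => complex.Im (f x)) &
               (Linfty_norm f < +oo)%E]].

Section spaces.
Variables (T : R -> (Rn -> R[i]) -> (Rn -> R[i])) (alpha : R).

Definition ell_norm (f : Rn -> R[i]) : \bar R :=
  (Linfty_norm f +
   ereal_sup [set ((t `^ alpha)^-1)%:E *
     (Linfty_norm (fun x => T t (fun y => `|f y| ^+ 2) x - `|T t f x| ^+ 2)%R)
       `^ 2^-1 | t in [set t : R | (0 < t)%R]])%E.

Definition calL_norm (f : Rn -> R[i]) : \bar R :=
  (Linfty_norm f +
   ereal_sup [set ((t `^ alpha)^-1)%:E *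
     (Linfty_norm (T t (fun y => `|f y - T t f y| ^+ 2)%R))
       `^ 2^-1 | t in [set t : R | (0 < t)%R]])%E.

Definition ell_space : set (Rn -> R[i]) :=
  [set f | Linfty f /\ (ell_norm f < +oo)%E].

Definition calL_space : set (Rn -> R[i]) :=
  [set f | Linfty f /\ (calL_norm f < +oo)%E].

End spaces.
End semigroups.

Definition coincide_with_equivalent_norms (R : realType) (V : Type)
    (X Y : set V) (normX normY : V -> \bar R) : Prop :=
  X = Y /\
  exists c C : R, [/\ 0 < c, 0 < C &
    forall f, X f -> (c%:E * normX f <= normY f <= C%:E * normX f)%E].

(* Main.v *)
(* If [T_t] is averaging against [k_t], [T_t|f|^2 - |T_t f|^2] at [x] is the
   [k_t]-average around [x] of [|f - T_t f(x)|^2] (a variance), while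
   [T_t|f - T_t f|^2] at [x] is the same average of [|f(y) - T_t f(y)|^2]. The
   two differ by the [k_t]-average [D] of [|T_t f(y) - T_t f(x)|^2], so it
   suffices to bound [D] by a constant times [t^(2 alpha)] under either
   hypothesis. Both hypotheses give
     [|T_t f(y) - T_(2t) f(x)| <= const * t^alpha] at distance one scale:
   the first by Harnack and Cauchy-Schwarz; the second by comparing [T_t f],
   [T_t T_t f] and [T_t T_(2t) f = T_(2t) T_t f] (only the commutation of the
   averages is used, not the semigroup law), then summing the Lipschitz bounds
   of [T_s T_s f - T_(2s) T_(2s) f] over dyadic [s >= t]. Telescoping over dyadic
   scales then bounds [|T_t f(y) - T_t f(x)|] on each dyadic annulus around [x],
   and the decay of the kernel (where [2 alpha < 1] enters) sums the annuli. *)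

(* The kernels enter only through [dyadic_kernel], and the size $Mt^\alpha$ only through its ratio
   [lam] $=2^\alpha$ between consecutive scales. Two numerical conditions remain: [lam ^+ 2 < 2]
   sums the annuli, [theta * lam < 1] sums the Lipschitz bounds. For the heat kernel
   $\theta=2^{-1/2}$ and the two conditions agree; for the Poisson kernel $\theta=1/2$ and the
   second follows from the first. The second hypothesis is the harder one. It controls $f-T_tf$ in
   the mean at scale $t$, whereas Harnack only bounds averages at a small scale by averages at a
   larger one. The opposite passage holds for bounds valid at all centres at once ([avg_upscale]).
   Moreover $T_sf-T_{2s}f$ is not visibly an average of a small function, so it gains no smoothness;
   $T_sT_sf-T_{2s}T_{2s}f$ is a sum of two averages of it, which is why the iterated averages
   appear. All estimates are made at every point, for bounded real functions. Essential bounds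
   become pointwise ones because the variance and the dispersion are uniformly continuous, and the
   real and imaginary parts of $f$ are treated separately. *)
From HB Require Import structures.
Require Import Defs.
From mathcomp Require Import all_boot all_order all_algebra.
From mathcomp Require Import complex.
From mathcomp Require Import all_classical all_reals all_analysis.
From mathcomp Require Import measurable_realfun ess_sup_inf.
From mathcomp Require Import ring lra.

Set Implicit Arguments.
Unset Strict Implicit.
Unset Printing Implicit Defensive.

Import Order.TTheory GRing.Theory Num.Theory.
Import numFieldNormedType.Exports.

Local Open Scope classical_set_scope.
Local Open Scope ring_scope.

(** * Lebesgue measure on tuples *)

Section tuple_measure.
Context (R : realType).
Implicit Types n : nat.
Local Notation leb n := (lebesgue_tuple R n).

Lemma measurable_fun_tuple_sub d (T : measurableType d) n
    (f g : T -> n.-tuple R) :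
  measurable_fun setT f -> measurable_fun setT g ->
  measurable_fun setT (fun z => tuple_sub (f z) (g z)).
Proof.
move=> mf mg; apply/measurable_fun_tnthP => i.
rewrite (_ : _ \o _ = fun z => tnth (f z) i - tnth (g z) i); last first.
  by apply/funext => z; rewrite /= tnth_mktuple.
apply: measurable_funB.
  by apply: (measurableT_comp (measurable_tnth i) mf).
by apply: (measurableT_comp (measurable_tnth i) mg).
Qed.

Lemma measurable_sqnorm n : measurable_fun setT (@sqnorm R n).
Proof.
rewrite /sqnorm; apply: measurable_sum => i.
apply: measurable_funX; exact: measurable_tnth.
Qed.

Lemma ge0_integral_lebesgue_cons n (f : n.+1.-tuple R -> \bar R) :
  measurable_fun setT f -> (forall x, (0 <= f x)%E) ->
  (\int[leb n.+1]_x f x =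
   \int[@lebesgue_measure R]_a \int[leb n]_s f [tuple of a :: s])%E.
Proof.
move=> mf f0.
transitivity (\int[pushforward (@lebesgue_measure R \x leb n)
  (@cons_pair R n)]_x f x)%E.
  by [].
rewrite ge0_integral_pushforward//=; last exact: measurable_cons_pair.
rewrite preimage_setT fubini_tonelli1//=.
exact: (measurableT_comp mf (@measurable_cons_pair R n)).
Qed.

Definition reflection (c : R) : measurableTypeR R -> measurableTypeR R :=
  fun y => c - y.

Lemma measurable_reflection c : measurable_fun setT (reflection c).
Proof. exact: measurable_funB. Qed.

HB.instance Definition _ c :=
  isMeasurableFun.Build _ _ _ _ (reflection c) (measurable_reflection c).

Lemma lebesgue_measure_reflection (c : R) (A : set R) : measurable A ->
  pushforward (@lebesgue_measure R) (reflection c) A = lebesgue_measure A.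
Proof.
move=> mA; apply/esym/lebesgue_measure_unique => //= _ [[a b]] _ <-.
rewrite /pushforward /=.
rewrite (_ : _ @^-1` _ = `[c - b, c - a[%classic); last first.
  apply/seteqP; split => y /=; rewrite /reflection !in_itv/= => /andP[? ?];
  by apply/andP; split; lra.
rewrite !lebesgue_measure_itv/= !lte_fin.
rewrite (_ : (c - b < c - a) = (a < b)); last by rewrite ltrD2l ltrN2.
by case: ifP => // _; rewrite -!EFinD; congr EFin; ring.
Qed.

Lemma ge0_integral_reflection1 (c : R) (f : R -> \bar R) :
  measurable_fun setT f -> (forall x, (0 <= f x)%E) ->
  (\int[lebesgue_measure]_y f (c - y)%R = \int[lebesgue_measure]_y f y)%E.
Proof.
move=> mf f0.
transitivity (\int[pushforward (@lebesgue_measure R) (reflection c)]_y f y)%E.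
  by rewrite ge0_integral_pushforward//= preimage_setT.
by apply: eq_measure_integral => //= A mA _; exact: lebesgue_measure_reflection.
Qed.

(** Tonelli and one reflection per coordinate. This one invariance gives both the unit mass of every
    recentred kernel $k(x-\cdot)$ and the commutation of averages. *)
Lemma ge0_integral_reflection n (x : n.-tuple R) (f : n.-tuple R -> \bar R) :
  measurable_fun setT f -> (forall y, (0 <= f y)%E) ->
  (\int[leb n]_y f (tuple_sub x y) = \int[leb n]_y f y)%E.
Proof.
elim: n x f => [|n IH] x f mf f0.
  apply: eq_integral => y _; congr f.
  by rewrite (tuple0 y); apply: eq_from_tnth; case.
have mfs : measurable_fun setT (fun y => f (tuple_sub x y)).
  apply: (measurableT_comp mf); exact: measurable_fun_tuple_sub.
rewrite !ge0_integral_lebesgue_cons//.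
have mF : measurable_fun setT
    (fun a => \int[leb n]_s f [tuple of a :: s])%E.
  apply: (@measurable_fun_fubini_tonelli_F _ _ (measurableTypeR R) _ _ (leb n)
    (fun p => f [tuple of p.1 :: p.2])) => //.
  exact: (measurableT_comp mf (@measurable_cons_pair R n)).
rewrite -(ge0_integral_reflection1 (thead x) mF); last first.
  by move=> a; exact: integral_ge0.
apply: eq_integral => a _.
rewrite -(IH [tuple of behead x] (fun s => f [tuple of (thead x - a) :: s])) //.
  apply: eq_integral => s _; congr f.
  apply: eq_from_tnth => i; rewrite tnth_mktuple.
  case: (unliftP ord0 i) => [j ->|->].
    rewrite !tnthS tnth_mktuple; congr (_ - _).
    by rewrite [in LHS](tuple_eta x) tnthS.
  by rewrite !tnth0.
apply: (measurableT_comp mf).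
exact: measurable_cons.
Qed.

Lemma measurable_sqnorm_ball n (x : n.-tuple R) (e : R) :
  measurable [set y | sqnorm (tuple_sub x y) < e].
Proof.
rewrite -[X in measurable X]setTI.
rewrite (_ : [set y | _] =
  (fun y => sqnorm (tuple_sub x y)) @^-1` `]-oo, e[%classic); last first.
  by apply/seteqP; split => y /=; rewrite in_itv.
apply: (measurableT_comp (@measurable_sqnorm n)) => //.
exact: measurable_fun_tuple_sub.
Qed.

Lemma lebesgue_tuple_ball_gt0 n (x : n.-tuple R) (e : R) : 0 < e ->
  (0 < leb n [set y | (sqnorm (tuple_sub x y) < e)%R])%E.
Proof.
move=> e0.
(* The cube of half-side $h=\min(1,e/(n+1))$ lies in the ball: $h^2\le h\le e/(n+1)$, and $n$ such
   squares sum to less than $e$. The cap at 1 avoids a square root, and $n+1$ keeps the bound strict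
   and covers dimension 0. *)
have e1 : 0 < Num.min 1 (e / n.+1%:R).
  by rewrite lt_min ltr01 divr_gt0.
set h := Num.min 1 (e / n.+1%:R) in e1.
pose B := [set y : n.-tuple R | forall i,
  `]tnth x i - h, tnth x i + h[%classic (tnth y i)].
have BE : leb n B = (\prod_(i < n) (2 * h)%:E)%E.
  rewrite /B (lebesgue_tuple_box (A := fun i =>
    `]tnth x i - h, tnth x i + h[%classic)); last first.
    by move=> i; exact: measurable_itv.
  apply: eq_bigr => i _; rewrite lebesgue_measure_itv/= lte_fin.
  rewrite ifT; last by lra.
  by rewrite -EFinD; congr EFin; ring.
have B0 : (0 < leb n B)%E.
  by rewrite BE prodEFin lte_fin prodr_gt0// => i _; rewrite mulr_gt0.
apply: (lt_le_trans B0); apply: le_measure; rewrite ?inE.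
- rewrite (_ : B = \big[setI/setT]_(i < n)
    ((@tnth n R)^~ i @^-1` `]tnth x i - h, tnth x i + h[)); last first.
    apply/seteqP; split => y /=; rewrite -bigcap_seq/=.
      by move=> Hy i _; exact: Hy.
    by move=> Hy i; apply: Hy => /=; rewrite mem_index_enum.
  apply: bigsetI_measurable => i _; rewrite -[X in measurable X]setTI.
  exact: measurable_tnth.
- exact: measurable_sqnorm_ball.
move=> y By /=.
have hle : forall i, tnth (tuple_sub x y) i ^+ 2 <= e / n.+1%:R.
  move=> i; have := By i; rewrite tnth_mktuple /= in_itv/= => /andP[h1 h2].
  set a := _ - _.
  have ah : `|a| <= h by rewrite ler_norml /a; apply/andP; split; lra.
  rewrite -real_normK ?num_real//.
  have h11 : h <= 1 by rewrite /h ge_min lexx.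
  have h12 : h <= e / n.+1%:R by rewrite /h ge_min lexx orbT.
  rewrite expr2 -[leRHS]mul1r; apply: ler_pM => //; exact: le_trans ah _.
apply: (@le_lt_trans _ _ (\sum_(i < n) e / n.+1%:R)).
  by apply: ler_sum => i _; exact: hle.
rewrite sumr_const card_ord -[_ *+ n]mulr_natr mulrAC ltr_pdivrMr//.
by rewrite ltr_pM2l// ltr_nat.
Qed.

(** Needed because the norm of exponent $+\infty$ is defined as the essential supremum only on a
    space of positive measure. *)
Lemma lebesgue_tupleT_gt0 n : (0 < leb n setT)%E.
Proof.
apply: (lt_le_trans (lebesgue_tuple_ball_gt0 [tuple 0 | i < n] ltr01)).
by apply: le_measure; rewrite ?inE//; exact: measurable_sqnorm_ball.
Qed.

End tuple_measure.

(** * Averages against a probability kernel *)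

Section bounded_measurable.
Context (R : realType) d (T : measurableType d).
Implicit Types f g : T -> R.

(** The bound is required at every point, so that integrands can be compared pointwise; elements of
    $L^\infty$ are brought into this class by [Linfty_clip]. *)
Definition bounded_measurable f :=
  measurable_fun setT f /\ exists B, forall x, `|f x| <= B.

Lemma bm_cst c : bounded_measurable (fun=> c).
Proof. by split; [exact: measurable_cst|exists `|c|]. Qed.

Lemma bmD f g : bounded_measurable f -> bounded_measurable g ->
  bounded_measurable (fun x => f x + g x).
Proof.
move=> [mf [B fB]] [mg [D gD]]; split; first exact: measurable_funD.
by exists (B + D) => x; rewrite (le_trans (ler_normD _ _))// lerD.
Qed.

Lemma bmM f g : bounded_measurable f -> bounded_measurable g ->
  bounded_measurable (fun x => f x * g x).
Proof.
move=> [mf [B fB]] [mg [D gD]]; split; first exact: measurable_funM.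
by exists (B * D) => x; rewrite normrM ler_pM.
Qed.

Lemma bmZ c f : bounded_measurable f -> bounded_measurable (fun x => c * f x).
Proof. by move=> bf; apply: bmM => //; exact: bm_cst. Qed.

Lemma bmN f : bounded_measurable f -> bounded_measurable (fun x => - f x).
Proof.
move=> [mf [B fB]]; split; first exact: measurable_funN.
by exists B => x; rewrite normrN.
Qed.

Lemma bmB f g : bounded_measurable f -> bounded_measurable g ->
  bounded_measurable (fun x => f x - g x).
Proof. by move=> bf bg; apply: bmD => //; exact: bmN. Qed.

Lemma bm_sqr f : bounded_measurable f -> bounded_measurable (fun x => f x ^+ 2).
Proof. by move=> bf; exact: (bmM bf bf). Qed.

Lemma bm_norm f : bounded_measurable f -> bounded_measurable (fun x => `|f x|).
Proof.
move=> [mf [B fB]]; split; first exact: measurableT_comp.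
by exists B => x; rewrite normr_id.
Qed.

Lemma bm_bound f : bounded_measurable f ->
  exists2 B, 0 <= B & forall x, `|f x| <= B.
Proof.
move=> [_ [B fB]]; exists `|B| => // x; exact: le_trans (fB x) (ler_norm _).
Qed.

Lemma bm_sum (I : Type) (s : seq I) (F : I -> T -> R) :
  (forall i, bounded_measurable (F i)) ->
  bounded_measurable (fun x => \sum_(i <- s) F i x).
Proof.
move=> bF; elim: s => [|i s IH].
  under eq_fun do rewrite big_nil; exact: bm_cst.
by under eq_fun do rewrite big_cons; exact: bmD.
Qed.

End bounded_measurable.

Ltac bm := repeat first [assumption | apply: bm_cst | apply: bm_sqr
  | apply: bm_norm | apply: bmN | apply: bmD | apply: bmM].

Section distance.
Context (R : realType) (n : nat).
Implicit Types x y z : n.-tuple R.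

Lemma sqnorm_sub2 x y z :
  sqnorm (tuple_sub (tuple_sub x z) (tuple_sub y z)) = sqnorm (tuple_sub x y).
Proof.
by apply: eq_bigr => i _; rewrite !tnth_mktuple; congr (_ ^+ 2); ring.
Qed.

Lemma sqnorm_subC x y : sqnorm (tuple_sub x y) = sqnorm (tuple_sub y x).
Proof.
by apply: eq_bigr => i _; rewrite !tnth_mktuple -sqrrN opprB.
Qed.

Lemma sqnorm_sub0 x : sqnorm (tuple_sub x x) = 0.
Proof. by rewrite /sqnorm big1// => i _; rewrite tnth_mktuple subrr expr0n. Qed.

Lemma sqnorm_ge0 x : 0 <= sqnorm x.
Proof. by apply: sumr_ge0 => i _; exact: sqr_ge0. Qed.

End distance.

Section averaging.
Context (R : realType) (n : nat).
Local Notation Rn := (n.-tuple R).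
Local Notation leb := (lebesgue_tuple R n).
Local Notation bm := bounded_measurable.

Definition avg (k : Rn -> R) (x : Rn) (g : Rn -> R) : R :=
  \int[leb]_y (k (tuple_sub x y) * g y).

Definition prob_kernel (k : Rn -> R) := [/\ forall x, 0 <= k x,
  measurable_fun setT k & (\int[leb]_x (k x)%:E = 1)%E].

Lemma measurable_kernel_sub k x : prob_kernel k ->
  measurable_fun setT (fun y => k (tuple_sub x y)).
Proof.
case=> k0 mk _; apply: (measurableT_comp mk).
exact: measurable_fun_tuple_sub.
Qed.

Lemma integral_kernel k x : prob_kernel k ->
  (\int[leb]_y (k (tuple_sub x y))%:E = 1)%E.
Proof.
move=> kP; have [k0 mk <-] := kP.
rewrite (ge0_integral_reflection x (f := fun y => (k y)%:E))//.
  exact/measurable_EFinP.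
Qed.

Lemma integrable_avg k x g : prob_kernel k -> bm g ->
  leb.-integrable setT (EFin \o (fun y => k (tuple_sub x y) * g y)).
Proof.
move=> kP bg; have [k0 _ _] := kP; have [B B0 gB] := bm_bound bg.
have mk := measurable_kernel_sub x kP.
apply: (@le_integrable _ _ _ leb _ measurableT _
  (EFin \o (fun y => B * k (tuple_sub x y)))) => //.
- by apply/measurable_EFinP; apply: measurable_funM => //; case: bg.
- move=> y _ /=; rewrite lee_fin !normrM (ger0_norm (k0 _)) mulrC.
  by rewrite ler_wpM2r// (ger0_norm B0).
- apply: (@integrableZl _ _ _ leb _ measurableT B
    (fun y => (k (tuple_sub x y))%:E)).
  apply/integrableP; split; first exact/measurable_EFinP.
  under eq_integral do rewrite gee0_abs ?lee_fin//.
  by rewrite integral_kernel// ltry.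
Qed.

Lemma avgE k x g : prob_kernel k -> bm g ->
  ((avg k x g)%:E = \int[leb]_y (k (tuple_sub x y) * g y)%:E)%E.
Proof.
move=> kP bg; rewrite /avg /Rintegral fineK//.
exact: (integrable_fin_num _ (integrable_avg x kP bg)).
Qed.

Lemma eq_avg k x g h : (forall y, g y = h y) -> avg k x g = avg k x h.
Proof. by move=> gh; congr (avg k x _); apply/funext. Qed.

Arguments eq_avg {k x g} h.

Lemma avgD k x g h : prob_kernel k -> bm g -> bm h ->
  avg k x (fun y => g y + h y) = avg k x g + avg k x h.
Proof.
move=> kP bg bh; rewrite /avg -RintegralD//; try exact: integrable_avg.
by apply: eq_Rintegral => y _; rewrite mulrDr.
Qed.

Lemma avgZ k x c g : prob_kernel k -> bm g ->
  avg k x (fun y => c * g y) = c * avg k x g.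
Proof.
move=> kP bg; rewrite /avg -RintegralZl//; try exact: integrable_avg.
by apply: eq_Rintegral => y _; rewrite mulrCA.
Qed.

Lemma avg_cst k x c : prob_kernel k -> avg k x (fun=> c) = c.
Proof.
move=> kP; have bc := @bm_cst R _ Rn.
rewrite -[RHS]mulr1 -[in LHS](mulr1 c) avgZ//; congr (_ * _).
apply: EFin_inj; rewrite avgE//; under eq_integral do rewrite mulr1.
exact: integral_kernel.
Qed.

Lemma avgN k x g : prob_kernel k -> bm g ->
  avg k x (fun y => - g y) = - avg k x g.
Proof.
by move=> kP bg; rewrite -mulN1r -avgZ//; apply: eq_avg; move=> y; rewrite mulN1r.
Qed.

Lemma avgB k x g h : prob_kernel k -> bm g -> bm h ->
  avg k x (fun y => g y - h y) = avg k x g - avg k x h.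
Proof. by move=> kP bg bh; rewrite avgD// ?avgN//; exact: bmN. Qed.

Lemma avg_sum k x (I : Type) (s : seq I) (F : I -> Rn -> R) : prob_kernel k ->
  (forall i, bm (F i)) ->
  avg k x (fun y => \sum_(i <- s) F i y) = \sum_(i <- s) avg k x (F i).
Proof.
move=> kP bF; elim: s => [|i s IH].
  rewrite big_nil -[RHS](avg_cst x 0 kP); apply: eq_avg; move=> y.
  by rewrite big_nil.
rewrite big_cons -IH -avgD//; last exact: bm_sum.
by apply: eq_avg; move=> y; rewrite big_cons.
Qed.

Lemma le_avg2 k k' x x' g h : prob_kernel k -> prob_kernel k' -> bm g -> bm h ->
  (forall y, k (tuple_sub x y) * g y <= k' (tuple_sub x' y) * h y) ->
  avg k x g <= avg k' x' h.
Proof.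
move=> kP kP' bg bh gh; apply: le_Rintegral => //; exact: integrable_avg.
Qed.

Lemma le_avg k x g h : prob_kernel k -> bm g -> bm h ->
  (forall y, g y <= h y) -> avg k x g <= avg k x h.
Proof.
move=> kP bg bh gh; apply: le_avg2 => // y.
by rewrite ler_wpM2l//; case: kP.
Qed.

Lemma le_avg_comb k x g h1 h2 c1 c2 :
  prob_kernel k -> bm g -> bm h1 -> bm h2 ->
  (forall y, g y <= c1 * h1 y + c2 * h2 y) ->
  avg k x g <= c1 * avg k x h1 + c2 * avg k x h2.
Proof.
move=> kP bg bh1 bh2 gh.
have b1 : bm (fun y => c1 * h1 y) by exact: bmZ.
have b2 : bm (fun y => c2 * h2 y) by exact: bmZ.
rewrite -(avgZ x c1 kP bh1) -(avgZ x c2 kP bh2) -(avgD x kP b1 b2).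
by apply: le_avg => //; exact: bmD.
Qed.

Lemma le_avg_ker k k' c x x' g : prob_kernel k -> prob_kernel k' -> bm g ->
  (forall y, 0 <= g y) ->
  (forall y, k (tuple_sub x y) <= c * k' (tuple_sub x' y)) ->
  avg k x g <= c * avg k' x' g.
Proof.
move=> kP kP' bg g0 kk; rewrite -avgZ//; apply: le_avg2 => //.
  exact: bmZ.
by move=> y; rewrite mulrCA mulrA ler_wpM2r.
Qed.

Lemma avg_ge0 k x g : prob_kernel k -> (forall y, 0 <= g y) -> 0 <= avg k x g.
Proof.
by case=> k0 _ _ g0; apply: Rintegral_ge0 => y _; exact: mulr_ge0.
Qed.

Lemma le_norm_avg k x g : prob_kernel k -> bm g ->
  `|avg k x g| <= avg k x (fun y => `|g y|).
Proof.
move=> kP bg; rewrite ler_norml -avgN//; last exact: bm_norm.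
apply/andP; split; apply: le_avg => //; try by bm.
  by move=> y; rewrite lerNl -normrN ler_norm.
by move=> y; exact: ler_norm.
Qed.

Lemma norm_avg_le k x g B : prob_kernel k -> bm g -> (forall y, `|g y| <= B) ->
  `|avg k x g| <= B.
Proof.
move=> kP bg gB; apply: le_trans (le_norm_avg x kP bg) _.
rewrite -[leRHS](avg_cst x _ kP); apply: le_avg => //.
  exact: bm_norm.
exact: bm_cst.
Qed.

(** At [c = avg k x g] the right side collapses to the variance. This yields Jensen's inequality
    below, and later the reading of $T_t|f|^2-|T_tf|^2$ as a variance. *)
Lemma avg_sqrB k x g c : prob_kernel k -> bm g ->
  avg k x (fun y => (g y - c) ^+ 2) =
  avg k x (fun y => g y ^+ 2) - c * avg k x g *+ 2 + c ^+ 2.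
Proof.
move=> kP bg.
rewrite (eq_avg (fun y => (g y ^+ 2 + (- (2 * c)) * g y) + c ^+ 2)).
  rewrite !avgD ?avgZ ?avg_cst//; first (by ring);
  by bm.
by move=> y; ring.
Qed.

Lemma sqr_avg_le k x g : prob_kernel k -> bm g ->
  avg k x g ^+ 2 <= avg k x (fun y => g y ^+ 2).
Proof.
move=> kP bg; have := avg_sqrB x (avg k x g) kP bg.
have := @avg_ge0 k x (fun y => (g y - avg k x g) ^+ 2) kP (fun y => sqr_ge0 _).
move=> + E; rewrite E => ?; lra.
Qed.

Lemma measurable_avg k g : prob_kernel k -> bm g ->
  measurable_fun setT (fun x => avg k x g).
Proof.
move=> kP bg; have [B B0 gB] := bm_bound bg; have [k0 mk _] := kP.
have bgB : bm (fun y => g y + B) by apply: bmD => //; exact: bm_cst.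
(* Adding the bound [B] makes the integrand nonnegative, so measurability in [x] comes from Tonelli;
   the kernel having mass one, the shift is subtracted again. *)
rewrite (_ : (fun x => _) =
  (fun x => fine (\int[leb]_y (k (tuple_sub x y) * (g y + B))%:E) - B)); last first.
  apply/funext => x; transitivity (avg k x (fun y => g y + B) - B) => //.
  by rewrite avgD// ?avg_cst ?addrK//; exact: bm_cst.
apply: measurable_funB => //; apply: measurableT_comp => //.
apply: (@measurable_fun_fubini_tonelli_F _ _ _ _ _ leb
  (fun p => (k (tuple_sub p.1 p.2) * (g p.2 + B))%:E)).
  apply/measurable_EFinP; apply: measurable_funM.
    apply: (measurableT_comp mk); exact: measurable_fun_tuple_sub.
  by case: bgB => mgB _; exact: (measurableT_comp mgB).
move=> [x y] /=; rewrite lee_fin mulr_ge0//.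
by have := gB y; rewrite ler_norml => /andP[? _]; lra.
Qed.

Lemma bm_avg k g : prob_kernel k -> bm g -> bm (fun x => avg k x g).
Proof.
move=> kP bg; split; first exact: measurable_avg.
have [B B0 gB] := bm_bound bg; exists B => x; exact: norm_avg_le.
Qed.

Let ge0_avg_avg k k' x g : prob_kernel k -> prob_kernel k' -> bm g ->
  (forall y, 0 <= g y) ->
  ((avg k x (fun y => avg k' y g))%:E =
   \int[leb]_z \int[leb]_y
     (k (tuple_sub x y) * (k' (tuple_sub y z) * g z))%:E)%E.
Proof.
move=> kP kP' bg g0; have [k0 mk _] := kP; have [k'0 mk' _] := kP'.
have [mg _] := bg.
rewrite avgE//; last exact: bm_avg.
transitivity (\int[leb]_y \int[leb]_z
    (k (tuple_sub x y) * (k' (tuple_sub y z) * g z))%:E)%E.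
  apply: eq_integral => y _; rewrite EFinM avgE//.
  under [in RHS]eq_integral do rewrite EFinM.
  rewrite ge0_integralZl//.
  - apply/measurable_EFinP; apply: measurable_funM => //.
    exact: measurable_kernel_sub.
  - by move=> z _; rewrite lee_fin mulr_ge0.
  - by rewrite lee_fin.
apply: (@fubini_tonelli _ _ _ _ _ leb leb
  (fun p => (k (tuple_sub x p.1) * (k' (tuple_sub p.1 p.2) * g p.2))%:E)).
  apply/measurable_EFinP; apply: measurable_funM.
    apply: (measurableT_comp mk); exact: measurable_fun_tuple_sub.
  apply: measurable_funM; last exact: (measurableT_comp mg).
  apply: (measurableT_comp mk'); exact: measurable_fun_tuple_sub.
by move=> [y z] /=; rewrite lee_fin !mulr_ge0.
Qed.

Let ge0_avgC k k' x g : prob_kernel k -> prob_kernel k' -> bm g ->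
  (forall y, 0 <= g y) ->
  avg k x (fun y => avg k' y g) = avg k' x (fun y => avg k y g).
Proof.
move=> kP kP' bg g0; have [k0 mk _] := kP; have [k'0 mk' _] := kP'.
apply: EFin_inj.
rewrite (ge0_avg_avg x kP kP' bg g0) (ge0_avg_avg x kP' kP bg g0).
apply: eq_integral => z _.
(* The reflection $y\mapsto x+z-y$ exchanges $x-y$ and $y-z$, hence the roles of the two kernels. *)
rewrite -(ge0_integral_reflection [tuple tnth x i + tnth z i | i < n]
  (f := fun y => (k (tuple_sub x y) * (k' (tuple_sub y z) * g z))%:E)).
- apply: eq_integral => y _; congr EFin; rewrite mulrCA; congr (_ * (_ * _)).
    by congr (k' _); apply: eq_from_tnth => i; rewrite !tnth_mktuple; ring.
  by congr (k _); apply: eq_from_tnth => i; rewrite !tnth_mktuple; ring.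
- apply/measurable_EFinP; apply: measurable_funM.
    exact: measurable_kernel_sub.
  apply: measurable_funM => //.
  apply: (measurableT_comp mk'); exact: measurable_fun_tuple_sub.
- by move=> y; rewrite lee_fin !mulr_ge0.
Qed.

Lemma avgC k k' x g : prob_kernel k -> prob_kernel k' -> bm g ->
  avg k x (fun y => avg k' y g) = avg k' x (fun y => avg k y g).
Proof.
move=> kP kP' bg; have [B B0 gB] := bm_bound bg.
(* The shift by [B] reduces to a nonnegative function and passes unchanged through both averages. *)
have bgB : bm (fun y => g y + B) by apply: bmD => //; exact: bm_cst.
have gB0 y : 0 <= g y + B.
  by have := gB y; rewrite ler_norml => /andP[? _]; lra.
have aux h l x' : prob_kernel l -> bm h ->
    avg l x' (fun y => h y + B) = avg l x' h + B.
  by move=> lP bh; rewrite avgD ?avg_cst//; exact: bm_cst.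
have aux2 l l' : prob_kernel l -> prob_kernel l' ->
    avg l x (fun y => avg l' y (fun z => g z + B)) =
    avg l x (fun y => avg l' y g) + B.
  move=> lP lP'; rewrite -aux//; last exact: bm_avg.
  by apply: eq_avg => y; exact: aux.
apply: (@addIr _ B); rewrite -(aux2 _ _ kP kP') -(aux2 _ _ kP' kP).
exact: ge0_avgC.
Qed.

End averaging.

(** * Variance and dispersion for dyadic kernels *)

Section dyadic_sums.
Context (R : realType).
Implicit Types q a b : R.

Lemma half_itv : 0 <= (2^-1 : R) < 1.
Proof. by rewrite invr_ge0 ler0n/= invf_lt1// ltr1n. Qed.

Lemma exp_small q e : 0 <= q < 1 -> 0 < e -> exists J : nat, q ^+ J < e.
Proof.
move=> /andP[q0 q1] e0.
have : (fun J => q ^+ J) @ \oo --> (0 : R) by apply: cvg_expr; rewrite ger0_norm.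
move=> /cvgrPdist_lt /(_ _ e0)[J _ HJ]; exists J.
by have := HJ J (leqnn J); rewrite /= sub0r normrN ger0_norm// exprn_ge0.
Qed.

(** The form in which limits are taken: every telescoping sum below is finite, with a remainder of
    order [q ^+ J] discarded here, so no infinite series is formed. *)
Lemma le_exp_small q a b c : 0 <= q < 1 -> 0 <= c ->
  (forall J : nat, a <= b + c * q ^+ J) -> a <= b.
Proof.
move=> q01 c0 H; apply/ler_addgt0Pr => e e0.
have e1 : 0 < e / (c + 1) by rewrite divr_gt0// ltr_wpDl.
have [J HJ] := exp_small q01 e1.
apply: (le_trans (H J)); rewrite lerD2l.
move: HJ; rewrite ltr_pdivlMr ?ltr_wpDl// => /ltW; apply: le_trans.
by rewrite mulrC ler_wpM2l ?exprn_ge0//; [case/andP: q01|lra].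
Qed.

Lemma geometric_sum_le q J : 0 <= q < 1 ->
  \sum_(j < J) q ^+ j <= (1 - q)^-1.
Proof.
move=> /andP[q0 q1]; have q1' : 0 < 1 - q by rewrite subr_gt0.
suff -> : \sum_(j < J) q ^+ j = (1 - q ^+ J) / (1 - q).
  rewrite ler_pdivrMr// mulVf ?gt_eqF// gerBl; exact: exprn_ge0.
elim: J => [|J IH]; first by rewrite big_ord0 expr0 subrr mul0r.
by rewrite big_ord_recr /= IH exprS; field; rewrite gt_eqF.
Qed.

Lemma norm_le_of_sqr a b : 0 <= b -> a ^+ 2 <= b ^+ 2 -> `|a| <= b.
Proof.
by move=> b0; rewrite -[a ^+ 2]real_normK ?num_real// ler_sqr ?nnegrE.
Qed.

Lemma sqr_le_of_norm a b : `|a| <= b -> a ^+ 2 <= b ^+ 2.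
Proof.
move=> ab; have b0 : 0 <= b by apply: le_trans ab.
by rewrite -[a ^+ 2]real_normK ?num_real// ler_sqr ?nnegrE.
Qed.

Lemma ler_norm4 (a b c d : R) : `|a + b + c - d| <= `|a| + `|b| + `|c| + `|d|.
Proof.
apply: le_trans (ler_normB _ _) _; rewrite lerD2r.
by apply: le_trans (ler_normD _ _) _; rewrite lerD2r; exact: ler_normD.
Qed.

Lemma ler_dist_shift (a b c d : R) :
  `|a - b| <= `|(a - c) - (b - d)| + `|c - d|.
Proof.
rewrite -[a - b](subrK (c - d)) (_ : a - b - _ = (a - c) - (b - d)).
  exact: ler_normD.
by ring.
Qed.

Lemma sqrB_le2 (a b c : R) :
  (a - c) ^+ 2 <= 2 * (a - b) ^+ 2 + 2 * (b - c) ^+ 2.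
Proof. by have := sqr_ge0 ((a - b) - (b - c)); lra. Qed.

End dyadic_sums.

(** * Properties shared by the heat and Poisson kernels *)

Section dyadic_kernel.
Context (R : realType) (n : nat).
Local Notation Rn := (n.-tuple R).
Local Notation bm := bounded_measurable.

(* [rad t] is the square of the length scale of [k t]: it is [t] for the heat
   kernel and [t ^ 2] for the Poisson kernel. *)
Record dyadic_kernel (k : R -> Rn -> R) (rad : R -> R) (C theta : R) : Prop :=
  DyadicKernel {
  dk_const : 1 <= C ;
  dk_theta : 0 <= theta < 1 ;
  dk_prob : forall t, 0 < t -> prob_kernel (k t) ;
  dk_rad : forall t, 0 < t -> 0 < rad t ;
  dk_rad_unbounded : forall t D, 0 < t -> exists m : nat, D <= rad (2 ^+ m * t) ;
  dk_harnack : forall t x y, 0 < t -> sqnorm (tuple_sub x y) <= rad t ->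
    k t x <= C * k (2 * t) y ;
  dk_modulus : forall t x y (j : nat), 0 < t ->
    sqnorm (tuple_sub x y) <= rad t ->
    `|k (2 ^+ j * t) x - k (2 ^+ j * t) y| <=
      C * theta ^+ j * (k (2 ^+ j.+1 * t) x + k (2 ^+ j.+1 * t) y) ;
  dk_tail : forall t (j : nat), 0 < t -> exists2 s, 0 < s &
    forall z, rad (2 ^+ j * t) < sqnorm z -> k t z <= C * 2^-1 ^+ j * k s z }.
End dyadic_kernel.

(** * Harnack, smoothing and tail bounds for averages *)

Section averages_of_dyadic_kernel.
Context (R : realType) (n : nat).
Local Notation Rn := (n.-tuple R).
Local Notation leb := (lebesgue_tuple R n).
Local Notation bm := bounded_measurable.
Variables (k : R -> Rn -> R) (rad : R -> R) (C theta : R).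
Hypothesis K : dyadic_kernel k rad C theta.
Local Notation dist x y := (sqnorm (tuple_sub x y)).

Let C1 : 1 <= C := dk_const K.
Let C0 : 0 <= C. Proof. by apply: le_trans C1. Qed.
Let kP t : 0 < t -> prob_kernel (k t) := @dk_prob _ _ _ _ _ _ K t.
Let pow2_gt0 (t : R) j : 0 < t -> 0 < 2 ^+ j * t.
Proof. by move=> t0; rewrite mulr_gt0// exprn_gt0. Qed.
Let dbl_gt0 (t : R) : 0 < t -> 0 < 2 * t.
Proof. by move=> t0; rewrite mulr_gt0. Qed.
Let pow2S (t : R) j : 2 ^+ j.+1 * t = 2 * (2 ^+ j * t).
Proof. by rewrite exprS mulrA. Qed.

Lemma avg_doubling t x y g : 0 < t -> dist x y <= rad t -> bm g ->
  (forall z, 0 <= g z) -> avg (k t) x g <= C * avg (k (2 * t)) y g.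
Proof.
move=> t0 xy bg g0; apply: le_avg_ker => //; [exact: kP|exact/kP/dbl_gt0|].
by move=> z; apply: (dk_harnack K) => //; rewrite sqnorm_sub2.
Qed.

Lemma avg_doubling0 t x g : 0 < t -> bm g ->
  (forall z, 0 <= g z) -> avg (k t) x g <= C * avg (k (2 * t)) x g.
Proof.
by move=> t0; apply: avg_doubling => //; rewrite sqnorm_sub0 ltW ?(dk_rad K).
Qed.

(** A displacement of size one scale [t] is small relative to the scale [2 ^+ j * t], which is the
    source of the gain [theta ^+ j]. The factor 2 counts the two doubled kernels that dominate the
    kernel difference, each of mass one. *)
Lemma avg_modulus t x y j g B : 0 < t -> dist x y <= rad t -> bm g ->
  (forall z, `|g z| <= B) ->
  `|avg (k (2 ^+ j * t)) x g - avg (k (2 ^+ j * t)) y g| <=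
    2 * C * theta ^+ j * B.
Proof.
move=> t0 + bg gB.
have B0 : 0 <= B by apply: le_trans (gB x).
have kj := kP (pow2_gt0 j t0); have kj1 := kP (pow2_gt0 j.+1 t0).
suff aux x' y' : dist x' y' <= rad t ->
    avg (k (2 ^+ j * t)) x' g - avg (k (2 ^+ j * t)) y' g <=
    2 * C * theta ^+ j * B.
  move=> xy; rewrite ler_norml lerNl opprB; apply/andP; split; apply: aux => //.
  by rewrite sqnorm_subC.
move=> xy; set c := C * theta ^+ j * B.
(* The bound is rewritten as averages of a constant around both points, so that the claim reduces to
   [dk_modulus] under the integral sign. *)
have -> : 2 * C * theta ^+ j * B = avg (k (2 ^+ j.+1 * t)) x' (fun=> c) +
    avg (k (2 ^+ j.+1 * t)) y' (fun=> c).
  by rewrite !avg_cst// /c; ring.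
have bc : bm (fun _ : Rn => c) by exact: bm_cst.
rewrite /avg -RintegralB//; try exact: integrable_avg.
rewrite -RintegralD//; try exact: integrable_avg.
apply: le_Rintegral => //.
- apply: (@integrableB _ _ _ leb _ measurableT _ _
    (integrable_avg x' kj bg) (integrable_avg y' kj bg)).
- apply: (@integrableD _ _ _ leb _ measurableT _ _
    (integrable_avg x' kj1 bc) (integrable_avg y' kj1 bc)).
move=> z _; rewrite -mulrBl -mulrDl.
apply: (le_trans (ler_norm _)); rewrite normrM /c mulrA.
apply: ler_pM => //; rewrite [leRHS]mulrC.
by apply: (dk_modulus K) => //; rewrite sqnorm_sub2.
Qed.

Definition far t x : Rn -> R := \1_[set y | rad t < dist x y].

Lemma far1 t x y : rad t < dist x y -> far t x y = 1.
Proof. by move=> h; rewrite /far indicE mem_set. Qed.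

Lemma far0 t x y : dist x y <= rad t -> far t x y = 0.
Proof. by move=> h; rewrite /far indicE memNset//= ltNge h. Qed.

Lemma far_ge0 t x y : 0 <= far t x y.
Proof. by rewrite /far indicE. Qed.

Lemma bm_far t x : bm (far t x).
Proof.
split; last by exists 1 => y; rewrite /far indicE normr_nat lern1; case: (_ \in _).
apply: measurable_indic; rewrite -[X in measurable X]setTI.
rewrite (_ : [set y | _] = (fun y => dist x y) @^-1` `]rad t, +oo[%classic).
  apply: (measurableT_comp (@measurable_sqnorm R n)) => //.
  exact: measurable_fun_tuple_sub.
by apply/seteqP; split => y /=; rewrite in_itv/= andbT.
Qed.

(** Outside the ball the kernel is at most $C2^{-j}$ times another kernel of the family, which also
    has mass one. The scale [s] of that kernel may depend on [j] and leaves no trace in the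
    bound. *)
Lemma avg_far t x j : 0 < t ->
  avg (k t) x (far (2 ^+ j * t) x) <= C * 2^-1 ^+ j.
Proof.
move=> t0; have [s s0 Hs] := dk_tail K j t0.
have kt := kP t0; have ks := kP s0; set c := C * _.
have c0 : 0 <= c by rewrite mulr_ge0// exprn_ge0// invr_ge0.
rewrite -[leRHS](avg_cst x _ ks); apply: le_avg2 => //.
- exact: bm_far.
- exact: bm_cst.
move=> y; have [xy|xy] := leP (dist x y) (rad (2 ^+ j * t)).
  by rewrite far0// mulr0 mulr_ge0//; case: ks.
by rewrite far1// mulr1 mulrC Hs.
Qed.

(* By Harnack, an average at scale s is dominated by averages at the larger
   scale 2 s over the s-ball, and that ball carries at least half of the mass
   of the kernel at the smaller scale t. *)
Lemma avg_upscale q t g a : C * 2^-1 ^+ q <= 2^-1 -> 0 < t -> bm g ->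
  (forall z, 0 <= g z) -> (forall x, avg (k t) x g <= a) ->
  forall x, avg (k (2 ^+ q * t)) x g <= 2 * C * a.
Proof.
move=> q2 t0 bg g0 ga x; set s := 2 ^+ q * t.
have s0 : 0 < s := pow2_gt0 q t0.
have ks := kP s0; have kt := kP t0; have k2s := kP (dbl_gt0 s0).
have bF : bm (far s x) := bm_far s x.
have A0 : 0 <= avg (k s) x g by exact: avg_ge0.
have H : avg (k s) x g * avg (k t) x (fun y => 1 - far s x y) <=
    C * avg (k t) x (fun y => avg (k (2 * s)) y g).
  rewrite -!avgZ//; try by bm; try exact: bm_avg.
  apply: le_avg => //; try by bm; try exact: bm_avg.
  move=> y; have [xy|xy] := leP (dist x y) (rad s).
    by rewrite far0// subr0 mulr1; exact: avg_doubling.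
  rewrite far1// subrr mulr0 mulr_ge0//; exact: avg_ge0.
rewrite avgB ?avg_cst// in H; last exact: bm_cst.
have F2 := le_trans (avg_far x q t0) q2.
have : avg (k s) x g * 2^-1 <= C * a.
  apply: (@le_trans _ _ (avg (k s) x g * (1 - avg (k t) x (far s x)))).
    by rewrite ler_wpM2l// /s; lra.
  (* After commuting, the average at scale [t] is innermost, where the hypothesis bounds it by [a]
     at every centre. *)
  apply: le_trans H _; rewrite ler_wpM2l// avgC//.
  rewrite -[leRHS](avg_cst x _ k2s); apply: le_avg => //.
    exact: bm_avg.
  exact: bm_cst.
lra.
Qed.

(** The previous lemma reaches only a scale so large that at most half of the mass lies far away;
    [q] applications of Harnack, each costing [C], descend from there to [2 * t]. *)
Lemma avg_upscale2 q t g a : C * 2^-1 ^+ q.+1 <= 2^-1 -> 0 < t -> bm g ->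
  (forall z, 0 <= g z) -> (forall x, avg (k t) x g <= a) ->
  forall x, avg (k (2 * t)) x g <= C ^+ q * (2 * C) * a.
Proof.
move=> q2 t0 bg g0 ga x; rewrite -mulrA.
apply: (@le_trans _ _ (C ^+ q * avg (k (2 ^+ q.+1 * t)) x g)); last first.
  by rewrite ler_wpM2l ?exprn_ge0//; exact: avg_upscale.
elim: q {q2} => [|q IH]; first by rewrite expr0 expr1 mul1r.
apply: le_trans IH _.
rewrite [C ^+ q.+1]exprSr -mulrA ler_wpM2l ?exprn_ge0// [2 ^+ q.+2 * t]pow2S.
by apply: avg_doubling0 => //; exact: pow2_gt0.
Qed.

Section scales.
(* In the application [N t = M * t `^ alpha] and [lam = 2 `^ alpha]. *)
Variables (lam : R).
Hypotheses (lam1 : 1 < lam) (lam2 : lam ^+ 2 < 2) (lamth : theta * lam < 1).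
Variables (N : R -> R) (f : Rn -> R).
Hypotheses (N0 : forall t, 0 < t -> 0 <= N t)
  (N2 : forall t, 0 < t -> N (2 * t) = lam * N t) (bf : bm f).

Let w t x := avg (k t) x f.
Let v t x := avg (k t) x (w t).

Let lam0 : 0 < lam. Proof. exact: lt_trans lam1. Qed.

Let bw t : 0 < t -> bm (w t).
Proof. by move=> t0; apply: bm_avg => //; exact: kP. Qed.

Let bv t : 0 < t -> bm (v t).
Proof. by move=> t0; apply: bm_avg; [exact: kP|exact: bw]. Qed.

Let N2X t j : 0 < t -> N (2 ^+ j * t) = lam ^+ j * N t.
Proof.
move=> t0; elim: j => [|j IH]; first by rewrite !expr0 !mul1r.
by rewrite pow2S N2 ?pow2_gt0// IH exprS mulrA.
Qed.

Definition scale_close (c : R) := forall t x y, 0 < t -> dist x y <= rad t ->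
  `|w t y - w (2 * t) x| <= c * N t.

Lemma variance_close :
  (forall t x, 0 < t ->
     avg (k t) x (fun y => (f y - w t x) ^+ 2) <= N t ^+ 2) ->
  scale_close (C * lam).
Proof.
move=> H t x y t0 xy.
have t20 := dbl_gt0 t0; have Nt0 := N0 t0.
have kt := kP t0.
have cl0 : 0 <= C * lam by rewrite mulr_ge0// ltW.
set c := w (2 * t) x.
have bc : bm (fun z => f z - c) by bm.
apply: norm_le_of_sqr; first by rewrite mulr_ge0.
have -> : w t y - c = avg (k t) y (fun z => f z - c).
  by rewrite avgB ?avg_cst//; exact: bm_cst.
apply: le_trans (sqr_avg_le _ kt bc) _.
(* Since [1 <= C], the factor [C] may be replaced by [C ^+ 2], which keeps the final constant free
   of square roots. *)
apply: (@le_trans _ _ (C * N (2 * t) ^+ 2)); last first.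
  rewrite N2// (_ : (C * lam * N t) ^+ 2 = C ^+ 2 * (lam * N t) ^+ 2); last ring.
  by rewrite ler_wpM2r ?sqr_ge0// expr2 ler_peMl.
apply: (@le_trans _ _ (C * avg (k (2 * t)) x (fun z => (f z - c) ^+ 2))).
  apply: avg_doubling => //; [by rewrite sqnorm_subC|exact: bm_sqr|].
  by move=> z; exact: sqr_ge0.
by rewrite ler_wpM2l//; exact: H.
Qed.

(** * Oscillation of the averages at a fixed scale *)

Section oscillation.
Variable c : R.
Hypotheses (c0 : 0 <= c) (cl : scale_close c).

Let close0 t x : 0 < t -> `|w t x - w (2 * t) x| <= c * N t.
Proof. by move=> t0; apply: cl => //; rewrite sqnorm_sub0 ltW ?(dk_rad K). Qed.

(** The geometric sum $1+\lambda+\dots+\lambda^m$ in closed form. *)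
Let S m := (lam ^+ m.+1 - 1) / (lam - 1).

Let SS m : S m.+1 = 1 + lam * S m.
Proof.
rewrite /S exprS; field; rewrite subr_eq0 gt_eqF//.
Qed.

(** Both points climb through the scales until they are within one radius of each other. The step at
    scale [2 ^+ i * t] costs [c * N (2 ^+ i * t)] for each point, hence the factor 2 and the
    geometric sum. *)
Lemma oscillation_sum m t x y : 0 < t -> dist x y <= rad (2 ^+ m * t) ->
  `|w t x - w t y| <= 2 * c * N t * S m.
Proof.
elim: m t => [|m IH] t t0.
  rewrite expr0 mul1r /S expr1 divff ?mulr1; last first.
    by rewrite subr_eq0 gt_eqF//.
  move=> xy; rewrite (_ : w t x - w t y =
    (w t x - w (2 * t) x) - (w t y - w (2 * t) x)); last by ring.
  rewrite (le_trans (ler_normB _ _))//.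
  have := close0 x t0; have := cl t0 xy; lra.
rewrite exprSr -mulrA => /(IH _ (dbl_gt0 t0)); rewrite N2// SS => H.
rewrite (_ : w t x - w t y = (w t x - w (2 * t) x) +
  (w (2 * t) x - w (2 * t) y) - (w t y - w (2 * t) y)); last by ring.
rewrite (le_trans (ler_normB _ _))//.
have := ler_normD (w t x - w (2 * t) x) (w (2 * t) x - w (2 * t) y).
have := close0 x t0; have := close0 y t0; lra.
Qed.

(** Comes from [S m <= lam ^+ m.+1 / (lam - 1)], with [lam ^+ m] left out as the dependence on the
    distance. *)
Definition osc_const := 2 * c * lam / (lam - 1).

Lemma oscillation m t x y : 0 < t -> dist x y <= rad (2 ^+ m * t) ->
  `|w t x - w t y| <= osc_const * N t * lam ^+ m.
Proof.
move=> t0 /(oscillation_sum t0); move=> /le_trans; apply.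
rewrite /S /osc_const.
have l1 : 0 < lam - 1 by rewrite subr_gt0.
rewrite (_ : 2 * c * lam / (lam - 1) * N t * lam ^+ m =
  2 * c * N t * (lam ^+ m.+1 / (lam - 1))); last first.
  by rewrite exprS; field; rewrite gt_eqF.
rewrite ler_wpM2l//; first by rewrite !mulr_ge0// N0.
by rewrite ler_pM2r ?invr_gt0// gerBl.
Qed.

Let L := lam ^+ 2.

Lemma mean_sqr_oscillation t x : 0 < t ->
  avg (k t) x (fun y => (w t y - w t x) ^+ 2) <=
  osc_const ^+ 2 * (1 + 2 * C / (1 - L / 2)) * N t ^+ 2.
Proof.
move=> t0; have kt := kP t0; have Nt0 := N0 t0.
have [B B0 fB] := bm_bound bf.
have wB y : `|w t y| <= B by apply: norm_avg_le.
have oc0 : 0 <= osc_const.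
  apply: divr_ge0; last by rewrite subr_ge0 ltW.
  by apply: mulr_ge0; [exact: mulr_ge0|exact: ltW].
set a := osc_const ^+ 2 * N t ^+ 2.
have a0 : 0 <= a by rewrite mulr_ge0// sqr_ge0.
have L0 : 0 <= L by rewrite sqr_ge0.
have aL j : 0 <= a * L ^+ j by apply: mulr_ge0 => //; exact: exprn_ge0.
pose F J y := far (2 ^+ J * t) x y.
have bF J : bm (F J) by exact: bm_far.
have F0 J y : 0 <= F J y by exact: far_ge0.
have near_bound y m : dist x y <= rad (2 ^+ m * t) ->
    (w t y - w t x) ^+ 2 <= a * L ^+ m.
  move=> xy; rewrite /a /L -exprM mulnC exprM -!exprMn.
  rewrite -[leLHS]sqrrN opprB; apply: sqr_le_of_norm; exact: oscillation.
(* A majorant by nested exteriors of balls instead of disjoint annuli: the overcount is harmless and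
   each term is handled by [avg_far]. Beyond the last ball only the crude bound $2B$ is used; its
   contribution is of order $2^{-J}$ after averaging. *)
have ptw J y : (w t y - w t x) ^+ 2 <=
    a + \sum_(j < J) a * L ^+ j.+1 * F j y + (2 * B) ^+ 2 * F J y.
  have sum0 J' : 0 <= \sum_(j < J') a * L ^+ j.+1 * F j y.
    by apply: sumr_ge0 => j _; exact: mulr_ge0.
  have glob : (w t y - w t x) ^+ 2 <= (2 * B) ^+ 2.
    apply: sqr_le_of_norm; rewrite (le_trans (ler_normB _ _))//.
    have := wB x; have := wB y; lra.
  elim: J => [|J IH].
    rewrite big_ord0 addr0; have [xy|xy] := leP (dist x y) (rad (2 ^+ 0 * t)).
      have := near_bound _ _ xy; rewrite /F (far0 xy); lra.
    rewrite /F (far1 xy); lra.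
  have [xy|xy] := leP (dist x y) (rad (2 ^+ J * t)).
    move: IH; rewrite /F (far0 xy) mulr0 addr0 => /le_trans; apply.
    rewrite big_ord_recr /= -/(F J.+1 y) -!addrA lerD2l lerDl.
    by apply: addr_ge0; apply: mulr_ge0 => //; exact: sqr_ge0.
  rewrite big_ord_recr /= /F (far1 xy) mulr1.
  have [xy1|xy1] := leP (dist x y) (rad (2 ^+ J.+1 * t)).
    have := near_bound _ _ xy1; have := sum0 J; rewrite (far0 xy1) /F; lra.
  have := sum0 J; have := aL J.+1; rewrite (far1 xy1) /F; lra.
have q01 : 0 <= L / 2 < 1 by rewrite divr_ge0//= ltr_pdivrMr// mul1r.
have h01 := half_itv R.
apply: (@le_exp_small _ 2^-1 _ _ ((2 * B) ^+ 2 * C)) => //.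
  by rewrite mulr_ge0// sqr_ge0.
move=> J.
apply: (le_trans (le_avg x kt _ _ (ptw J))); try by bm; exact: bw.
  apply: bmD; last by bm.
  by apply: bmD; [exact: bm_cst|apply: bm_sum => j; bm].
have bFj j : bm (fun y => a * L ^+ (nat_of_ord j).+1 * F (nat_of_ord j) y) by bm.
rewrite avgD//; [|by apply: bmD; [exact: bm_cst|exact: bm_sum]|by bm].
rewrite avgD//; [|exact: bm_cst|exact: bm_sum].
rewrite avg_cst// avgZ// avg_sum//.
apply: lerD; last by rewrite -mulrA ler_wpM2l ?sqr_ge0//; exact: avg_far.
rewrite (_ : osc_const ^+ 2 * _ * _ = a + a * C * 2 * (1 - L / 2)^-1); last first.
  by rewrite /a; ring.
rewrite lerD2l.
(* Growth [L ^+ j.+1] of the squared oscillation against tail mass $C2^{-j}$: the ratio is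
   [L / 2 < 1], and the spare factor [L] is bounded by 2. *)
apply: (@le_trans _ _ (\sum_(j < J) a * C * L * (L / 2) ^+ j)).
  apply: ler_sum => j _; rewrite avgZ//.
  rewrite (_ : a * C * L * (L / 2) ^+ j = a * L ^+ j.+1 * (C * 2^-1 ^+ j)).
    by rewrite ler_wpM2l// avg_far.
  by rewrite exprMn exprS; ring.
rewrite -mulr_sumr; apply: ler_pM => //.
- by apply: mulr_ge0 => //; exact: mulr_ge0.
- by apply: sumr_ge0 => j _; rewrite exprn_ge0//; case/andP: q01.
- by apply: ler_wpM2l; [exact: mulr_ge0|exact: ltW].
- exact: geometric_sum_le.
Qed.

End oscillation.

Lemma variance_dispersion t x : 0 < t ->
  avg (k t) x (fun y => (f y - w t y) ^+ 2) <=
    2 * avg (k t) x (fun y => (f y - w t x) ^+ 2) +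
    2 * avg (k t) x (fun y => (w t y - w t x) ^+ 2).
Proof.
move=> t0; have kt := kP t0; have bwt := bw t0.
apply: le_avg_comb => //; try by bm.
move=> y; have := sqrB_le2 (f y) (w t x) (w t y).
by rewrite -(sqrrN (w t x - w t y)) opprB.
Qed.

Lemma dispersion_variance t x : 0 < t ->
  avg (k t) x (fun y => (f y - w t x) ^+ 2) <=
    2 * avg (k t) x (fun y => (f y - w t y) ^+ 2) +
    2 * avg (k t) x (fun y => (w t y - w t x) ^+ 2).
Proof.
move=> t0; have kt := kP t0; have bwt := bw t0.
apply: le_avg_comb => //; try by bm.
move=> y; exact: sqrB_le2.
Qed.

(** * The dispersion bound controls neighbouring scales *)

Section dispersion.
Variable C' : R.
Hypothesis C'1 : 1 <= C'.
Hypothesis up : forall t g a, 0 < t -> bm g ->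
  (forall z, 0 <= g z) -> (forall x, avg (k t) x g <= a) ->
  forall x, avg (k (2 * t)) x g <= C' * a.
Hypothesis H : forall t x, 0 < t ->
  avg (k t) x (fun y => (f y - w t y) ^+ 2) <= N t ^+ 2.

Let c1 := 2 + 2 * C * lam ^+ 2.
Let c2 := C' * c1.

Let c1_ge1 : 1 <= c1.
Proof.
have : 0 <= 2 * C * lam ^+ 2 by rewrite mulr_ge0 ?sqr_ge0// mulr_ge0.
by rewrite /c1; lra.
Qed.

Let c2_ge1 : 1 <= c2.
Proof. by rewrite /c2 -[leLHS]mulr1 ler_pM. Qed.

Let fw_bm t : 0 < t -> bm (fun y => f y - w t y).
Proof. by move=> t0; have bt := bw t0; bm. Qed.

(** The difference is the average of [f - w t], so Jensen bounds its square by the dispersion. *)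
Let wv t x : 0 < t -> `|w t x - v t x| <= N t.
Proof.
move=> t0; have kt := kP t0; rewrite -avgB//; last exact: bw.
apply: norm_le_of_sqr; first exact: N0.
by apply: le_trans (H x t0); apply: sqr_avg_le => //; exact: fw_bm.
Qed.

Let u t y := w t y - w (2 * t) y.

Let bu t : 0 < t -> bm (u t).
Proof. by move=> t0; have b1 := bw t0; have b2 := bw (dbl_gt0 t0); rewrite /u; bm. Qed.

(** Compare both averages with [f]. The dispersion at scale [2 * t] is brought down to the kernel at
    scale [t] by Harnack; this gives the two terms of [c1]. *)
Let avg_u t x : 0 < t -> avg (k t) x (fun y => u t y ^+ 2) <= c1 * N t ^+ 2.
Proof.
move=> t0; have t20 := dbl_gt0 t0; have kt := kP t0.
have b1 := fw_bm t0; have b2 := fw_bm t20; have bt := bu t0.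
apply: (@le_trans _ _ (2 * avg (k t) x (fun y => (f y - w t y) ^+ 2) +
    2 * avg (k t) x (fun y => (f y - w (2 * t) y) ^+ 2))).
  apply: le_avg_comb => //; try by bm.
  move=> y; have := sqrB_le2 (w t y) (f y) (w (2 * t) y).
  by rewrite -(sqrrN (w t y - f y)) opprB.
have h1 := H x t0.
have : avg (k t) x (fun y => (f y - w (2 * t) y) ^+ 2) <=
    C * (lam ^+ 2 * N t ^+ 2).
  apply: (@le_trans _ _
      (C * avg (k (2 * t)) x (fun y => (f y - w (2 * t) y) ^+ 2))).
    by apply: avg_doubling0 => //; [exact: bm_sqr|move=> z; exact: sqr_ge0].
  rewrite ler_wpM2l// -exprMn -N2//; exact: H.
move=> h2; rewrite (_ : c1 * _ = 2 * N t ^+ 2 + 2 * (C * (lam ^+ 2 * N t ^+ 2))).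
  by apply: lerD; rewrite ler_pM2l.
by rewrite /c1; ring.
Qed.

Let norm_avg_u t x : 0 < t -> `|avg (k t) x (u t)| <= c1 * N t.
Proof.
move=> t0; have kt := kP t0; apply: norm_le_of_sqr.
  by rewrite mulr_ge0 ?N0// (le_trans ler01).
apply: le_trans (sqr_avg_le _ kt (bu t0)) _.
apply: (le_trans (avg_u x t0)); rewrite exprMn ler_wpM2r ?sqr_ge0//.
by rewrite expr2 ler_peMl// (le_trans ler01).
Qed.

(** Here a bound at scale [t] is needed at the larger scale, against the direction of Harnack; this
    is what [up] is for. *)
Let norm_avg2_u t x : 0 < t -> `|avg (k (2 * t)) x (u t)| <= c2 * N t.
Proof.
move=> t0; have kt := kP (dbl_gt0 t0); apply: norm_le_of_sqr.
  by rewrite mulr_ge0 ?N0// (le_trans ler01).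
apply: le_trans (sqr_avg_le _ kt (bu t0)) _.
have := up t0 (bm_sqr (bu t0)) (fun z => sqr_ge0 _) (fun x => avg_u x t0) x.
move=> /le_trans; apply; rewrite mulrA -/c2 exprMn ler_wpM2r ?sqr_ge0//.
by rewrite expr2 ler_peMl// (le_trans ler01).
Qed.

Let c3 := 1 + c1 + c2 + lam.

(* The commutation of the averages at scales t and 2 t replaces the semigroup
   property here. *)
Let norm_u t x : 0 < t -> `|u t x| <= c3 * N t.
Proof.
move=> t0; have t20 := dbl_gt0 t0; have kt := kP t0; have k2t := kP t20.
have bt := bw t0; have b2t := bw t20.
(* The two averages of [u t] expand to $v_t-A_tw_{2t}$ and $A_{2t}w_t-v_{2t}$, where $A_s$ averages
   at scale $s$. The mixed terms cancel by commutation, and the four summands give the four terms of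
   [c3]. *)
have -> : u t x = (w t x - v t x) + avg (k t) x (u t) +
    avg (k (2 * t)) x (u t) - (w (2 * t) x - v (2 * t) x).
  rewrite /u !avgB// -/(v t x) -/(v (2 * t) x) [avg (k t) x (w (2 * t))]avgC//.
  by rewrite -/(w t); ring.
apply: le_trans (ler_norm4 _ _ _ _) _.
rewrite (_ : c3 * N t = N t + c1 * N t + c2 * N t + lam * N t); last first.
  by rewrite /c3; ring.
rewrite -[lam * N t]N2//; apply: lerD; last exact: wv.
by apply: lerD; [apply: lerD; [exact: wv|exact: norm_avg_u]|exact: norm_avg2_u].
Qed.

(** By commutation $v_s-v_{2s}$ is the sum of the averages of [u s] at scales [s] and [2 * s]. The
    size of [u s] grows like [lam ^+ j] while the modulus of the averages decays like
    [theta ^+ j]. *)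
Let v_step t x y j : 0 < t -> dist x y <= rad t ->
  `|(v (2 ^+ j * t) x - v (2 ^+ j.+1 * t) x) -
    (v (2 ^+ j * t) y - v (2 ^+ j.+1 * t) y)| <=
  4 * C * c3 * N t * (theta * lam) ^+ j.
Proof.
move=> t0 xy; set s := 2 ^+ j * t; rewrite pow2S -/s.
have s0 : 0 < s := pow2_gt0 j t0; have s20 := dbl_gt0 s0.
have ks := kP s0; have k2s := kP s20; have bs := bw s0; have b2s := bw s20.
have vE z : v s z - v (2 * s) z = avg (k s) z (u s) + avg (k (2 * s)) z (u s).
  rewrite /u !avgB// -/(v s z) -/(v (2 * s) z) [avg (k s) z (w (2 * s))]avgC//.
  by rewrite -/(w s); ring.
have uB z : `|u s z| <= c3 * (lam ^+ j * N t).
  by rewrite -N2X//; exact: norm_u.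
have h1 := avg_modulus j t0 xy (bu s0) uB.
have h2 := avg_modulus j.+1 t0 xy (bu s0) uB.
rewrite pow2S -/s in h2; rewrite -/s in h1.
rewrite !vE (_ : _ - _ = (avg (k s) x (u s) - avg (k s) y (u s)) +
  (avg (k (2 * s)) x (u s) - avg (k (2 * s)) y (u s))); last by ring.
have /andP[th0 th1] := dk_theta K.
have X0 : 0 <= c3 * (lam ^+ j * N t) by apply: le_trans (uB x).
have h3 : 2 * C * theta ^+ j.+1 * (c3 * (lam ^+ j * N t)) <=
    2 * C * theta ^+ j * (c3 * (lam ^+ j * N t)).
  apply: ler_wpM2r => //.
  by rewrite ler_wpM2l ?mulr_ge0// exprS ler_piMl ?exprn_ge0// ltW.
rewrite (le_trans (ler_normD _ _))//.
rewrite (_ : 4 * C * c3 * N t * (theta * lam) ^+ j =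
  2 * C * theta ^+ j * (c3 * (lam ^+ j * N t)) +
  2 * C * theta ^+ j * (c3 * (lam ^+ j * N t))).
  by apply: lerD => //; exact: le_trans h2 h3.
by rewrite exprMn; ring.
Qed.

Let c4 := 4 * C * c3 / (1 - theta * lam).

(** Telescoping upwards from [t] to [2 ^+ J * t]; the last term is an average of a function bounded
    by [B], so it vanishes like [theta ^+ J]. *)
Let v_modulus t x y : 0 < t -> dist x y <= rad t ->
  `|v t x - v t y| <= c4 * N t.
Proof.
move=> t0 xy; have /andP[th0 th1] := dk_theta K.
have [B B0 fB] := bm_bound bf.
have thl0 : 0 <= theta * lam by rewrite mulr_ge0// ltW.
have cc0 : 0 <= 4 * C * c3 * N t.
  rewrite mulr_ge0 ?N0// mulr_ge0 ?mulr_ge0// /c3.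
  by have := c1_ge1; have := c2_ge1; have := lam0; lra.
apply: (@le_exp_small _ theta _ _ (2 * C * B)); rewrite ?th0 ?mulr_ge0// => J.
have wB s z : 0 < s -> `|w s z| <= B by move=> s0; exact: norm_avg_le (kP s0) _ _.
have last_term := avg_modulus J t0 xy (bw (pow2_gt0 J t0))
  (fun z => wB _ z (pow2_gt0 J t0)).
apply: (@le_trans _ _ (\sum_(j < J) 4 * C * c3 * N t * (theta * lam) ^+ j +
    `|v (2 ^+ J * t) x - v (2 ^+ J * t) y|)).
  elim: J {last_term} => [|J IH].
    by rewrite big_ord0 add0r expr0 mul1r.
  apply: (le_trans IH); rewrite big_ord_recr /= -addrA lerD2l.
  apply: le_trans (ler_dist_shift _ _ (v (2 ^+ J.+1 * t) x)
    (v (2 ^+ J.+1 * t) y)) _.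
  by apply: lerD => //; exact: v_step.
apply: lerD; last by move: last_term; rewrite /v; lra.
rewrite -mulr_sumr /c4 [leRHS]mulrAC.
by rewrite ler_wpM2l// geometric_sum_le// thl0.
Qed.

Lemma dispersion_close : scale_close (2 + c3 + c4).
Proof.
move=> t x y t0 xy.
(* The route is $w_t(y)\to v_t(y)\to v_t(x)\to w_t(x)\to w_{2t}(x)$: the displacement is carried out
   on the smoother function [v t]. *)
rewrite (_ : w t y - w (2 * t) x = (w t y - v t y) - (v t x - v t y) +
   u t x - (w t x - v t x)); last by rewrite /u; ring.
rewrite (le_trans (ler_normB _ _))//.
have h1 := ler_normD (w t y - v t y - (v t x - v t y)) (u t x).
have h2 := ler_normB (w t y - v t y) (v t x - v t y).
have := wv x t0; have := wv y t0; have := norm_u x t0.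
have := v_modulus t0 xy; lra.
Qed.

End dispersion.
End scales.

Theorem variance_dispersion_equiv lam : 1 < lam -> lam ^+ 2 < 2 ->
  theta * lam < 1 ->
  exists2 c, 0 < c & forall (N : R -> R) (f : Rn -> R),
    (forall t, 0 < t -> 0 <= N t) ->
    (forall t, 0 < t -> N (2 * t) = lam * N t) -> bm f ->
  ((forall t x, 0 < t ->
     avg (k t) x (fun y => (f y - avg (k t) x f) ^+ 2) <= N t ^+ 2) ->
   forall t x, 0 < t ->
     avg (k t) x (fun y => (f y - avg (k t) y f) ^+ 2) <= (c * N t) ^+ 2) /\
  ((forall t x, 0 < t ->
     avg (k t) x (fun y => (f y - avg (k t) y f) ^+ 2) <= N t ^+ 2) ->
   forall t x, 0 < t ->
     avg (k t) x (fun y => (f y - avg (k t) x f) ^+ 2) <= (c * N t) ^+ 2).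
Proof.
move=> lam1 lam2 lamth.
have lam0 : 0 < lam by apply: lt_trans lam1.
have h01 := half_itv R.
(* At this [q] at most half of the mass of [k t] lies beyond scale [2 ^+ q.+1 * t], as the upscaling
   lemmas require. *)
have [q Hq] : exists q : nat, C * 2^-1 ^+ q.+1 <= 2^-1.
  have [q Hq] : exists q : nat, 2^-1 ^+ q < C^-1.
    by apply: exp_small => //; rewrite invr_gt0 (lt_le_trans ltr01).
  exists q; rewrite exprSr mulrA ler_piMl//.
  by move: Hq => /ltW; rewrite -[leRHS]mul1r ler_pdivlMr ?(lt_le_trans ltr01)// mulrC.
pose C' := C ^+ q * (2 * C).
have C'1 : 1 <= C'.
  have hC : 1 <= C := dk_const K.
  have hq : 1 <= C ^+ q by exact: exprn_ege1.
  by rewrite /C' -[leLHS]mulr1; apply: ler_pM => //; lra.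
have up t g a : 0 < t -> bm g ->
    (forall z, 0 <= g z) -> (forall x, avg (k t) x g <= a) ->
    forall x, avg (k (2 * t)) x g <= C' * a.
  exact: avg_upscale2.
pose D c := osc_const lam c ^+ 2 * (1 + 2 * C / (1 - lam ^+ 2 / 2)).
(* These repeat the constants of the dispersion argument, so that the witness is fixed before [N]
   and [f] are given. *)
set c1 := 2 + 2 * C * lam ^+ 2; set c2 := C' * c1.
set c3 := 1 + c1 + c2 + lam; set c4 := 4 * C * c3 / (1 - theta * lam).
set cl := 2 + c3 + c4.
have th0 : 0 <= theta by case/andP: (dk_theta K).
have c10 : 0 <= c1 by rewrite addr_ge0// mulr_ge0 ?sqr_ge0// mulr_ge0.
have c20 : 0 <= c2 by rewrite mulr_ge0// (le_trans ler01).
have c30 : 0 <= c3 by rewrite /c3; lra.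
have c40 : 0 <= c4 by rewrite divr_ge0 ?mulr_ge0// subr_ge0 ltW.
have cl0 : 0 <= cl by rewrite /cl; lra.
have Clam0 : 0 <= C * lam by rewrite mulr_ge0// ltW.
have D0 c : 0 <= D c.
  rewrite mulr_ge0 ?sqr_ge0// addr_ge0// divr_ge0 ?mulr_ge0//.
  by rewrite subr_ge0 ler_pdivrMr// mul1r ltW.
(* Large enough for the constant of either direction, and at least 1, so that [M <= M ^+ 2]
   dispenses with a square root. *)
pose M := 2 + 2 * D (C * lam) + 2 * D cl.
have M1 : 1 <= M by rewrite /M; have := D0 (C * lam); have := D0 cl; lra.
have M0 : 0 <= M by lra.
exists M; first lra.
move=> N f N0 N2 bf.
have fin (t a b d : R) : 0 < t -> a <= 2 * b + 2 * d -> b <= N t ^+ 2 ->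
    d <= D (C * lam) * N t ^+ 2 \/ d <= D cl * N t ^+ 2 -> a <= (M * N t) ^+ 2.
  move=> t0 ab bN dN; rewrite exprMn.
  apply: (@le_trans _ _ (M * N t ^+ 2)); last first.
    by rewrite ler_wpM2r ?sqr_ge0// expr2 ler_peMl.
  have N20 : 0 <= N t ^+ 2 by exact: sqr_ge0.
  have e1 := mulr_ge0 (D0 (C * lam)) N20.
  have e2 := mulr_ge0 (D0 cl) N20.
  by rewrite /M; case: dN; lra.
split=> H t x t0.
- apply: (fin t _ _ _ t0 (variance_dispersion bf x t0) (H t x t0)); left.
  by apply: mean_sqr_oscillation => //; exact: variance_close.
- apply: (fin t _ _ _ t0 (dispersion_variance bf x t0) (H t x t0)); right.
  by apply: mean_sqr_oscillation => //; exact: dispersion_close.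
Qed.

End averages_of_dyadic_kernel.

(** * The heat kernel *)

Section kernel_estimates.
Context (R : realType) (n : nat).
Implicit Types x y : n.-tuple R.
Local Notation dist x y := (sqnorm (tuple_sub x y)).

Lemma sqnorm_le2 x y : sqnorm y <= 2 * sqnorm x + 2 * dist x y.
Proof.
rewrite /sqnorm !mulr_sumr -big_split; apply: ler_sum => i _ /=.
rewrite tnth_mktuple; have := sqr_ge0 (tnth x i + (tnth x i - tnth y i)); lra.
Qed.

(** Coordinatewise $b^2-a^2=(b-a)(b+a)$, with the arithmetic-geometric inequality weighted by [e].
    Here [e] is the displacement relative to the length scale $\sqrt r$, and the single factor [e]
    in the conclusion becomes [theta ^+ j]. *)
Lemma sqnorm_sub_le x y e r : 0 < e -> dist x y <= e ^+ 2 * r ->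
  sqnorm y - sqnorm x <= e * (r / 2 + sqnorm x + sqnorm y).
Proof.
move=> e0 xy.
suff H : e * (sqnorm y - sqnorm x) <=
    dist x y / 2 + e ^+ 2 * (sqnorm x + sqnorm y).
  rewrite -(ler_pM2l e0); apply: le_trans H _; lra.
rewrite /sqnorm -sumrB !mulr_sumr mulr_suml -!big_split mulr_sumr -big_split.
apply: ler_sum => i _ /=; rewrite tnth_mktuple.
set a := tnth x i; set b := tnth y i.
have := sqr_ge0 ((b - a) - e * (a + b)).
have : 0 <= e ^+ 2 * (a - b) ^+ 2 by rewrite mulr_ge0// sqr_ge0.
lra.
Qed.

Lemma exists_pow2_ge (t D : R) : 0 < t -> exists m : nat, D <= 2 ^+ m * t.
Proof.
move=> t0; have D0 : 0 < `|D| + 1 by rewrite ltr_wpDl.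
have h01 := half_itv R.
have [m] := exp_small h01 (divr_gt0 t0 D0).
rewrite exprVn ltr_pdivlMr// mulrC ltr_pdivrMr ?exprn_gt0// => H.
by exists m; have := ler_norm D; lra.
Qed.

End kernel_estimates.

Section heat_kernel.
Context (R : realType).
Implicit Types n : nat.

Lemma measurable_heat_kernel n (t : R) :
  measurable_fun setT (@heat_kernel R n t).
Proof.
apply: measurable_funM => //; apply: measurableT_comp => //.
apply: measurable_funN; apply: measurable_funM => //; exact: measurable_sqnorm.
Qed.

Lemma heat_kernel_ge0 n (t : R) x : 0 <= @heat_kernel R n t x.
Proof. by rewrite mulr_ge0 ?powR_ge0 ?expR_ge0. Qed.

Lemma sqnorm_cons n (a : R) (s : n.-tuple R) :
  sqnorm [tuple of a :: s] = a ^+ 2 + sqnorm s.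
Proof.
rewrite /sqnorm big_ord_recl tnth0; congr (_ + _).
by apply: eq_bigr => i _; rewrite tnthS.
Qed.

(** One coordinate splits off as the centred normal density of variance $2t$, which reduces the
    total mass to dimension one. *)
Lemma heat_kernel_cons n (t a : R) (s : n.-tuple R) : 0 < t ->
  heat_kernel t [tuple of a :: s] =
  normal_pdf 0 (Num.sqrt (2 * t)) a * heat_kernel t s.
Proof.
move=> t0; have s0 : Num.sqrt (2 * t) != 0 by rewrite gt_eqF// sqrtr_gt0 mulr_gt0.
rewrite normal_pdfE// /normal_peak /normal_fun sqr_sqrtr ?mulr_ge0// ?ltW//.
rewrite /heat_kernel sqnorm_cons.
have -> : - (n.+1%:R / 2) = - 2^-1 + (- (n%:R / 2)) :> R by rewrite -natr1; field.
have p0 : 0 < 4 * pi * t by rewrite !mulr_gt0// pi_gt0.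
rewrite powRD; last by rewrite (gt_eqF p0) implybT.
rewrite [_ `^ (- 2^-1)]powRN powR12_sqrt ?ltW//.
rewrite (_ : 2 * t * pi *+ 2 = 4 * pi * t); last by ring.
rewrite subr0 (_ : - ((a ^+ 2 + sqnorm s) / (4 * t)) =
  - a ^+ 2 / (2 * t *+ 2) + - (sqnorm s / (4 * t))); last first.
  by field; rewrite gt_eqF.
by rewrite expRD; ring.
Qed.

Lemma integral_heat_kernel n (t : R) : 0 < t ->
  (\int[lebesgue_tuple R n]_x (heat_kernel t x)%:E = 1)%E.
Proof.
move=> t0; elim: n => [|n IH].
  rewrite integral_dirac//; first last.
    by apply/measurable_EFinP; exact: measurable_heat_kernel.
  rewrite diracT mul1e /heat_kernel /sqnorm big_ord0 mul0r oppr0 powRr0.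
  by rewrite mul0r oppr0 expR0 mulr1.
rewrite ge0_integral_lebesgue_cons; last 2 first.
- by apply/measurable_EFinP; exact: measurable_heat_kernel.
- by move=> x; rewrite lee_fin heat_kernel_ge0.
under eq_integral => a _.
  under eq_integral do rewrite heat_kernel_cons// EFinM.
  rewrite ge0_integralZl//; last 3 first.
  - by apply/measurable_EFinP; exact: measurable_heat_kernel.
  - by move=> x _; rewrite lee_fin heat_kernel_ge0.
  - by rewrite lee_fin normal_pdf_ge0.
  rewrite IH mule1.
  over.
exact: integral_normal_pdf.
Qed.

Lemma prob_heat_kernel n (t : R) : 0 < t -> prob_kernel (@heat_kernel R n t).
Proof.
move=> t0; split; [exact: heat_kernel_ge0|exact: measurable_heat_kernel|].
exact: integral_heat_kernel.
Qed.

(** Half of the exponent stays in the kernel at time [2 * t]; the other half is the spare Gaussian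
    decay that yields the tail bound. *)
Lemma heat_kernel_double n (t : R) x : 0 < t ->
  heat_kernel t x = 2 `^ (n%:R / 2) * expR (- (sqnorm x / (8 * t))) *
    @heat_kernel R n (2 * t) x.
Proof.
move=> t0; rewrite /heat_kernel.
have p0 : 0 <= 4 * pi * t by rewrite !mulr_ge0 ?pi_ge0// ltW.
rewrite (_ : 4 * pi * (2 * t) = 2 * (4 * pi * t)); last by ring.
rewrite (@powRM _ 2)// (_ : - (sqnorm x / (4 * t)) =
  - (sqnorm x / (8 * t)) + - (sqnorm x / (4 * (2 * t)))); last first.
  by field; rewrite gt_eqF.
rewrite expRD [2 `^ (- _)]powRN.
have : 2 `^ (n%:R / 2) != 0 :> R by rewrite gt_eqF// powR_gt0.
by move=> P0; field.
Qed.

(* The derivative bound |d/dr exp(-r^2)| <= const * exp(-r^2/2), in a form that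
   only involves the squares a, b. *)
Lemma expR_diff_le (a b e : R) : 0 < e -> 0 <= a ->
  b - a <= e * (8^-1 + a + b) ->
  expR (- a) - expR (- b) <= 8 * e * expR (- (a / 2)).
Proof.
move=> e0 a0 ab.
have E0 := expR_gt0 (- (a / 2)).
have aE : expR (- a) = expR (- (a / 2)) * expR (- (a / 2)).
  by rewrite -expRD; congr expR; field.
(* For [e] at least 1/4 the factor [8 * e] makes the trivial bound sufficient. For smaller [e], [b]
   can be absorbed to give $b-a\le 6e(1+a/2)$, and half of the exponential pays for the factor
   $1+a/2$. *)
have [e4|e4] := leP 4^-1 e.
  have := expR_gt0 (- b) => eb0.
  have : expR (- a) <= expR (- (a / 2)) by rewrite ler_expR; lra.
  have : 0 <= (8 * e - 1) * expR (- (a / 2)) by apply: mulr_ge0; lra.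
  lra.
have ab' : b - a <= 6 * e * (1 + a / 2).
  have : (b - a) * (1 - e) <= e * (8^-1 + 2 * a) by lra.
  have : e * (8^-1 + 2 * a) <= 6 * e * (1 + a / 2) * (1 - e).
    have : 0 <= e * ((6 + 3 * a) * (1 - e) - (8^-1 + 2 * a)).
      apply: mulr_ge0; first exact: ltW.
      have : 0 <= (6 + 3 * a) * (4^-1 - e) by apply: mulr_ge0; lra.
      lra.
    lra.
  move=> h1 h2; have := le_trans h2 h1; rewrite ler_pM2r//; lra.
have h1 : expR (- b) >= expR (- a) * (1 - (b - a)).
  have -> : - b = - a + - (b - a) by ring.
  by rewrite expRD ler_pM2l ?expR_gt0//; have := expR_ge1Dx (- (b - a)); lra.
have h2 : expR (- (a / 2)) * (1 + a / 2) <= 1.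
  rewrite -[leRHS](expRxMexpNx_1 (a / 2)) mulrC ler_pM2r//; exact: expR_ge1Dx.
apply: (@le_trans _ _ (expR (- a) * (6 * e * (1 + a / 2)))).
  have : expR (- a) * (b - a) <= expR (- a) * (6 * e * (1 + a / 2)).
    by rewrite ler_pM2l// expR_gt0.
  lra.
rewrite aE (_ : _ * _ * _ = 6 * e * expR (- (a / 2)) *
  (expR (- (a / 2)) * (1 + a / 2))); last by ring.
apply: (@le_trans _ _ (6 * e * expR (- (a / 2)) * 1)).
  by rewrite ler_wpM2l// !mulr_ge0// ltW.
have : 0 <= e * expR (- (a / 2)) by rewrite mulr_ge0// ltW.
lra.
Qed.

(** A displacement $\sqrt t$ measured at length scale $\sqrt{2^jt}$ is $2^{-j/2}$, whence [theta].
    In the constant, $2^{n/2}$ is the ratio of the normalisations at [t] and [2 * t], [expR 1]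
    serves Harnack, and 8 serves the modulus and the tail. *)
Lemma dyadic_heat_kernel n : dyadic_kernel (@heat_kernel R n) id
  (8 * expR 1 * 2 `^ (n%:R / 2)) (Num.sqrt 2^-1).
Proof.
set P := 2 `^ (n%:R / 2).
have P1 : 1 <= P by rewrite /P -[leLHS](powRr0 2) ler_powR ?ler1n ?divr_ge0.
have e1 : 1 <= expR 1 :> R by rewrite -[leLHS]expR0 ler_expR.
have e0 : 0 < expR 1 :> R := expR_gt0 1.
have P0 : 0 < P by apply: lt_le_trans P1.
have P0' : 0 <= P := ltW P0.
have eP1 : 1 <= expR 1 * P by rewrite -[leLHS]mulr1 ler_pM.
have P8C : 8 * P <= 8 * expR 1 * P by apply: ler_wpM2r; [exact: ltW|lra].
split.
- by rewrite -mulrA; lra.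
- rewrite sqrtr_ge0/= -[ltRHS]sqrtr1 ltr_sqrt// invf_lt1// ltr1n//.
- exact: prob_heat_kernel.
- by [].
- by move=> t D; exact: exists_pow2_ge.
- move=> t x y t0 xy; rewrite /= in xy.
  have ht : heat_kernel t x = P * (4 * pi * (2 * t)) `^ (- (n%:R / 2)) *
      expR (- (sqnorm x / (4 * t))).
    rewrite heat_kernel_double// -/P /heat_kernel -!mulrA; congr (_ * _).
    rewrite mulrCA; congr (_ * _); rewrite -expRD; congr expR.
    by field; rewrite gt_eqF.
  rewrite ht /heat_kernel.
  have X0 : 0 <= (4 * pi * (2 * t)) `^ (- (n%:R / 2)) := powR_ge0 _ _.
  set X := _ `^ _ in X0 *.
  rewrite (_ : 8 * expR 1 * P * (X * _) =
    P * X * (8 * (expR 1 * expR (- (sqnorm y / (4 * (2 * t))))))); last by ring.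
  rewrite ler_wpM2l ?mulr_ge0// -expRD.
  apply: (@le_trans _ _ (expR (1 - sqnorm y / (4 * (2 * t))))); last first.
    by have := expR_gt0 (1 - sqnorm y / (4 * (2 * t))); lra.
  rewrite ler_expR; have := sqnorm_le2 x y => xy2.
  rewrite -(ler_pM2r (_ : 0 < 8 * t)) ?mulr_gt0//.
  rewrite (_ : - (sqnorm x / (4 * t)) * (8 * t) = - 2 * sqnorm x); last first.
    by field; rewrite gt_eqF.
  rewrite (_ : (1 - sqnorm y / (4 * (2 * t))) * (8 * t) = 8 * t - sqnorm y).
    by lra.
  by field; rewrite gt_eqF.
- move=> t x y j t0 xy; rewrite /= in xy.
  set s := 2 ^+ j * t; have s0 : 0 < s by rewrite mulr_gt0// exprn_gt0.
  have -> : 2 ^+ j.+1 * t = 2 * s by rewrite exprS mulrA.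
  set e := Num.sqrt 2^-1 ^+ j.
  have e0' : 0 < e by rewrite exprn_gt0// sqrtr_gt0 invr_gt0.
  have es : e ^+ 2 * s = t.
    rewrite /e -exprM mulnC exprM sqr_sqrtr ?invr_ge0//.
    by rewrite /s mulrA -exprMn mulVf// expr1n mul1r.
  suff H (x' y' : n.-tuple R) : sqnorm (tuple_sub x' y') <= t ->
      heat_kernel s x' - heat_kernel s y' <=
      8 * P * e * heat_kernel (2 * s) x'.
    have H' (x' y' : n.-tuple R) : sqnorm (tuple_sub x' y') <= t ->
        heat_kernel s x' - heat_kernel s y' <=
        8 * expR 1 * P * e *
          (heat_kernel (2 * s) x' + heat_kernel (2 * s) y').
      move=> /H /le_trans; apply; apply: ler_pM => //.
      - by rewrite !mulr_ge0// ltW.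
      - exact: heat_kernel_ge0.
      - by rewrite ler_wpM2r// ltW.
      - by rewrite lerDl heat_kernel_ge0.
    rewrite ler_norml lerNl opprB; apply/andP; split; last exact: H'.
    by rewrite [X in _ <= _ * X]addrC; apply: H'; rewrite sqnorm_subC.
  move=> {xy}{}xy.
  have xy' : sqnorm y' - sqnorm x' <= e * (s / 2 + sqnorm x' + sqnorm y').
    by apply: sqnorm_sub_le => //; rewrite es.
  pose a := sqnorm x' / (4 * s); pose b := sqnorm y' / (4 * s).
  have ab : b - a <= e * (8^-1 + a + b).
    rewrite -(ler_pM2r (_ : 0 < 4 * s)) ?mulr_gt0//.
    rewrite (_ : (b - a) * (4 * s) = sqnorm y' - sqnorm x'); last first.
      by rewrite /a /b; field; rewrite gt_eqF.
    rewrite (_ : e * (8^-1 + a + b) * (4 * s) =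
      e * (s / 2 + sqnorm x' + sqnorm y')) //.
    by rewrite /a /b; field; rewrite gt_eqF.
  have a0 : 0 <= a by rewrite divr_ge0 ?sqnorm_ge0// mulr_ge0// ltW.
  have D := expR_diff_le e0' a0 ab.
  rewrite /heat_kernel -/a -/b -mulrBr.
  rewrite (_ : sqnorm x' / (4 * (2 * s)) = a / 2); last first.
    by rewrite /a; field; rewrite gt_eqF.
  rewrite (_ : 4 * pi * (2 * s) = 2 * (4 * pi * s)); last by ring.
  rewrite (@powRM _ 2)//; last by rewrite !mulr_ge0 ?pi_ge0// ltW.
  rewrite [2 `^ (- _)]powRN -/P.
  set X := _ `^ _; have X0 : 0 <= X := powR_ge0 _ _.
  rewrite (_ : 8 * P * e * _ = X * (8 * e * expR (- (a / 2)))).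
    by rewrite ler_wpM2l.
  by field; rewrite gt_eqF.
(* The spare factor is $e^{-u}$ with $u=|z|^2/(8t)$ and $8u\ge 2^j$ outside the ball; $ue^{-u}\le 1$
   turns it into $8\cdot 2^{-j}$. *)
- move=> t j t0; exists (2 * t); first by rewrite mulr_gt0.
  move=> z zt; rewrite heat_kernel_double// -/P.
  rewrite ler_wpM2r ?heat_kernel_ge0//.
  have u0 : 0 < sqnorm z / (8 * t).
    by rewrite divr_gt0// ?mulr_gt0// (lt_trans _ zt)// mulr_gt0// exprn_gt0.
  set u := sqnorm z / (8 * t) in u0 *.
  have uj : 2 ^+ j <= 8 * u.
    rewrite /u (_ : 8 * (sqnorm z / (8 * t)) = sqnorm z / t).
      by rewrite ler_pdivlMr// ltW.
    by field; rewrite gt_eqF.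
  have uE : expR (- u) <= 8 * 2^-1 ^+ j.
    rewrite exprVn ler_pdivlMr ?exprn_gt0//.
    apply: (@le_trans _ _ (expR (- u) * (8 * u))).
      by rewrite ler_wpM2l// expR_ge0.
    have : expR (- u) * u <= 1.
      rewrite -[leRHS](expRxMexpNx_1 u) mulrC ler_wpM2r ?expR_ge0//.
      by have := expR_ge1Dx u; lra.
    lra.
  apply: (@le_trans _ _ (P * (8 * 2^-1 ^+ j))).
    by rewrite ler_wpM2l// ltW.
  rewrite mulrA; apply: ler_wpM2r; first by rewrite exprn_ge0// invr_ge0.
  by rewrite mulrC.
Qed.

End heat_kernel.

(** * The Poisson kernel *)

Lemma ge0_integral_cstM d (T : measurableType d) (R : realType)
    (mu : {measure set T -> \bar R}) (D : set T) (c : R) (f : T -> R) :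
  measurable D -> measurable_fun D f -> (forall x, 0 <= f x) -> 0 <= c ->
  (\int[mu]_(x in D) (c * f x)%:E = c%:E * \int[mu]_(x in D) (f x)%:E)%E.
Proof.
move=> mD mf f0 c0; under eq_integral do rewrite EFinM.
apply: ge0_integralZl => //; first exact/measurable_EFinP.
by move=> x _; rewrite lee_fin.
Qed.

(** * Changes of variable on the half-line *)

Section substitution.
Context (R : realType).
Local Notation mu := (@lebesgue_measure R).

Let sq (a : R) := fun v : R => a * v ^+ 2.

Let derive1_sq a : derive1 (sq a) = fun v => 2 * a * v.
Proof.
apply/funext => v; rewrite derive1E /sq deriveZ//= exp_derive.
by rewrite /GRing.scale /= expr1 mulr1; ring.
Qed.

Let continuous_sq a : continuous (sq a).
Proof. by move=> v; apply: cvgMr; exact: exprn_continuous. Qed.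

Let integral_sqr_substitution_itv (a b : R) (g : R -> R) : 0 < a -> 0 <= b ->
  continuous g ->
  (\int[mu]_(u in `[0%R, (a * b ^+ 2)%R]) (g u)%:E =
   \int[mu]_(v in `[0%R, b]) (g (a * v ^+ 2) * (2 * a * v))%:E)%E.
Proof.
move=> a0 b0 cg.
have := @integration_by_substitution_increasing R (sq a) g 0 b b0.
rewrite /sq expr0n mulr0 derive1_sq => -> //.
- move=> x y; rewrite !in_itv/= => /andP[x0 _] /andP[y0 _] xy.
  by rewrite ltr_pM2l// ltr_sqr.
- by move=> x _; apply: cvgMr.
- apply/cvg_ex; exists (2 * a * 0); apply: cvg_at_right_filter; exact: cvgMr.
- apply/cvg_ex; exists (2 * a * b); apply: cvg_at_left_filter; exact: cvgMr.
- split.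
  + by move=> x _; apply: derivableZ; exact: exprn_derivable.
  + apply: cvg_at_right_filter; exact: continuous_sq.
  + apply: cvg_at_left_filter; exact: continuous_sq.
- exact: continuous_subspaceT.
Qed.

(** The formula on [[0, m]] and its image, passed to the half-line by monotone convergence. *)
Lemma integral_sqr_substitution (a : R) (g : R -> R) : 0 < a ->
  continuous g -> (forall u, 0 <= g u) ->
  (\int[mu]_(u in `[0%R, +oo[) (g u)%:E =
   \int[mu]_(v in `[0%R, +oo[) (g (a * v ^+ 2) * (2 * a * v))%:E)%E.
Proof.
move=> a0 cg g0.
have mg : measurable_fun setT g by exact: continuous_measurable_fun.
have mh : measurable_fun setT (fun v : R => g (a * v ^+ 2) * (2 * a * v)).
  apply: measurable_funM => //.
  by apply: measurableT_comp => //; apply: measurable_funM => //; exact: measurable_funX.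
have Egt (x : R) : exists m : nat, x <= m%:R.
  exists `|Num.ceil x|%N; rewrite (le_trans (ceil_ge x))//.
  by rewrite -[leRHS]mulrz_nat ler_int natz lez_abs.
pose F (m : nat) := `[0%R, (a * m%:R ^+ 2)]%classic : set R.
pose G (m : nat) := `[0%R, m%:R]%classic : set R.
have UF : \bigcup_m F m = `[0, +oo[%classic.
  apply/seteqP; split => x.
    by move=> [m _ /itvP xm]; rewrite /= in_itv/= xm.
  (* The added 1 ensures $m\ge 1$, hence $x/a\le m\le m^2$. *)
  rewrite /= in_itv/= andbT => x0; have [m Hm] := Egt (x / a + 1).
  exists m => //; rewrite /F /= in_itv/= x0/=.
  have xa : 0 <= x / a by rewrite divr_ge0// ltW.
  have : x / a <= m%:R ^+ 2.
    have m1 : 1 <= m%:R :> R by lra.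
    by apply: le_trans (_ : m%:R <= _); [lra|rewrite expr2 ler_peMl//; lra].
  by rewrite ler_pdivrMr// mulrC.
have UG : \bigcup_m G m = `[0, +oo[%classic.
  apply/seteqP; split => x.
    by move=> [m _ /itvP xm]; rewrite /= in_itv/= xm.
  rewrite /= in_itv/= andbT => x0; have [m Hm] := Egt x.
  by exists m => //; rewrite /G /= in_itv/= x0.
have cF : (\int[mu]_(u in F m) (g u)%:E)%E @[m --> \oo] -->
    (\int[mu]_(u in \bigcup_m F m) (g u)%:E)%E.
  apply: ge0_nondecreasing_set_cvg_integral => //.
  - move=> m k mk; apply/subsetPset => x; rewrite /F /= !in_itv/= => /andP[-> h].
    rewrite (le_trans h)// ler_pM2l// ler_sqr ?nnegrE// ler_nat//.
  - by move=> m; exact: measurable_itv.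
  - by move=> m; apply/measurable_EFinP; exact: measurable_funTS.
  - by move=> m x _; rewrite lee_fin.
have cG : (\int[mu]_(v in G m) (g (a * v ^+ 2) * (2 * a * v))%:E)%E
    @[m --> \oo] -->
    (\int[mu]_(v in \bigcup_m G m) (g (a * v ^+ 2) * (2 * a * v))%:E)%E.
  apply: ge0_nondecreasing_set_cvg_integral => //.
  - move=> m k mk; apply/subsetPset => x; rewrite /G /= !in_itv/= => /andP[-> h].
    by rewrite (le_trans h)// ler_nat.
  - by move=> m; exact: measurable_itv.
  - by move=> m; apply/measurable_EFinP; exact: measurable_funTS.
  - move=> m x; rewrite /G /= in_itv/= => /andP[x0 _].
    by rewrite lee_fin !mulr_ge0// ltW.
rewrite -[in LHS]UF -[in RHS]UG; apply: (cvg_unique _ cF) => //.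
rewrite (_ : (fun m => _) = (fun m : nat =>
  (\int[mu]_(v in G m) (g (a * v ^+ 2) * (2 * a * v))%:E)%E))//.
by apply/funext => m; exact: integral_sqr_substitution_itv.
Qed.

Lemma integral0y_gauss_scale (t : R) : 0 < t ->
  (\int[mu]_(v in `[0%R, +oo[) (expR (- (t ^+ 2 * v ^+ 2)))%:E =
   (Num.sqrt pi / (2 * t))%:E)%E.
Proof.
move=> t0.
pose F := fun v : R => t * v.
have dF : derive1 F = cst t.
  apply/funext => v; rewrite derive1E /F deriveZ//= derive_id.
  by rewrite /GRing.scale /= mulr1.
have := @increasing_ge0_integration_by_substitutiony R F gauss_fun 0.
have F0 : F 0 = 0 by rewrite /F mulr0.
rewrite F0 integral0y_gauss dF => H.
have {}H : ((Num.sqrt pi / 2)%:E =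
  \int[mu]_(x in `[0%R, +oo[) ((gauss_fun \o F) x * t)%:E)%E.
  rewrite H//.
  - move=> x y _ _ xy; by rewrite ltr_pM2l.
  - by move=> x _; exact: cvg_cst.
  - exact: is_cvg_cst.
  - exact: is_cvg_cst.
  - split.
    + by move=> x _; apply: derivableZ; exact: derivable_id.
    + apply: cvg_at_right_filter; exact: cvgMr.
  - exact: gt0_cvgMry.
  - apply: continuous_subspaceT; exact: continuous_gauss_fun.
  - by move=> x _; exact: gauss_fun_ge0.
move: H; under eq_integral do rewrite mulrC EFinM.
rewrite ge0_integralZl//; last 3 first.
- apply/measurable_EFinP; apply: measurable_funTS; apply: measurableT_comp.
    exact: measurable_gauss_fun.
  exact: measurable_funM.
- by move=> x _; rewrite lee_fin gauss_fun_ge0.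
- by rewrite lee_fin ltW.
move=> H; under eq_integral do rewrite -exprMn.
rewrite (_ : Num.sqrt pi / (2 * t) = t^-1 * (Num.sqrt pi / 2)); last first.
  by field; rewrite gt_eqF.
by rewrite EFinM H muleA -EFinM mulVf ?gt_eqF// mul1e.
Qed.

End substitution.

(** * Total mass and dyadic estimates of the Poisson kernel *)

Section poisson_kernel.
Context (R : realType).
Implicit Types n : nat.
Local Notation mu := (@lebesgue_measure R).

Lemma measurable_poisson_kernel n (t : R) :
  measurable_fun setT (@poisson_kernel R n t).
Proof.
apply: measurable_funM => //; apply: measurable_funM => //.
apply: (measurableT_comp (measurable_powR _)).
apply: measurable_funD => //; exact: measurable_sqnorm.
Qed.

(** On $u>0$ this is the integrand $u^{s-1}e^{-u}$ of $\Gamma(s)$ at $s=(n+2)/2$; written with a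
    square root it is continuous on the whole line. *)
Let gamma_density n (u : R) := Num.sqrt u ^+ n * expR (- u).

Let gamma_density_ge0 n u : 0 <= gamma_density n u.
Proof. by rewrite mulr_ge0 ?expR_ge0// exprn_ge0. Qed.

Let continuous_gamma_density n : continuous (gamma_density n).
Proof.
move=> u; apply: cvgM.
  apply: (@continuous_comp _ _ _ Num.sqrt (fun x : R => x ^+ n)).
    exact: sqrt_continuous.
  exact: exprn_continuous.
apply: (@continuous_comp _ _ _ -%R expR); first exact: continuousN.
exact: continuous_expR.
Qed.

(** The Gamma value is kept in the extended reals until it is known to be finite, which is itself
    read off from [mixture]. *)
Let E_Gamma n : \bar R := (\int[mu]_(u in `[0%R, +oo[) (gamma_density n u)%:E)%E.

Let GammaE n : Gamma (n.+2%:R / 2) = fine (E_Gamma n) :> R.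
Proof.
rewrite /Gamma /Rintegral /E_Gamma -integral_itv_obnd_cbnd; last first.
  apply/measurable_EFinP; apply: measurable_funTS.
  exact: continuous_measurable_fun.
congr fine; apply: eq_integral => u; rewrite inE/= in_itv/= andbT => u0.
congr EFin; congr (_ * _).
rewrite (_ : n.+2%:R / 2 - 1 = 2^-1 * n%:R); last by rewrite -!natr1; field.
by rewrite powRrM powR12_sqrt ?ltW// powR_mulrn.
Qed.

(* Subordination: the Poisson kernel is a Gamma mixture of Gaussians, written
   with the variable v = sqrt u so that the weight is smooth at 0. *)
Let subordination n (a : R) : 0 < a ->
  (E_Gamma n * (a `^ (- (n.+2%:R / 2)))%:E =
   \int[mu]_(v in `[0%R, +oo[) (2 * v ^+ n.+1 * expR (- (a * v ^+ 2)))%:E)%E.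
Proof.
move=> a0; rewrite /E_Gamma (integral_sqr_substitution a0 (@continuous_gamma_density n)
  (@gamma_density_ge0 n)).
rewrite muleC -ge0_integralZl//; last 3 first.
- apply/measurable_EFinP; apply: measurable_funTS; apply: measurable_funM => //.
  apply: (measurableT_comp (continuous_measurable_fun (@continuous_gamma_density n))).
  by apply: measurable_funM => //; exact: measurable_funX.
- move=> v /=; rewrite in_itv/= andbT => v0; rewrite lee_fin.
  by apply: mulr_ge0 => //; rewrite mulr_ge0// mulr_ge0// ltW.
- by rewrite lee_fin powR_ge0.
apply: eq_integral => v; rewrite inE/= in_itv/= andbT => v0.
rewrite -EFinM; congr EFin; rewrite /gamma_density.
rewrite sqrtrM ?ltW// sqrtr_sqr ger0_norm// powRN.
have -> : a `^ (n.+2%:R / 2) = Num.sqrt a ^+ n.+2.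
  by rewrite -powR12_sqrt ?ltW// -powR_mulrn ?powR_ge0// -powRrM mulrC.
have sa : Num.sqrt a != 0 by rewrite gt_eqF// sqrtr_gt0.
have aE : a = Num.sqrt a ^+ 2 by rewrite sqr_sqrtr// ltW.
set b := Num.sqrt a in sa aE *; set X := expR _.
rewrite (_ : 2 * a * v = 2 * b ^+ 2 * v); last by rewrite {1}aE.
have bn : b ^+ n != 0 by rewrite expf_neq0.
rewrite exprMn !exprS expr0; set p := b ^+ n in bn *.
by field; rewrite sa bn.
Qed.

(** The heat kernel at time $1/(4c)$ is this Gaussian divided by the claimed integral. *)
Let integral_gauss_tuple n (c : R) : 0 < c ->
  (\int[lebesgue_tuple R n]_x (expR (- (c * sqnorm x)))%:E =
   ((pi / c) `^ (n%:R / 2))%:E)%E.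
Proof.
move=> c0; have t0 : 0 < (4 * c)^-1 by rewrite invr_gt0 mulr_gt0.
have := integral_heat_kernel n t0.
have P0 : 0 < (pi / c) `^ (n%:R / 2) by rewrite powR_gt0// divr_gt0// pi_gt0.
have hE (x : n.-tuple R) : heat_kernel (4 * c)^-1 x =
    ((pi / c) `^ (n%:R / 2))^-1 * expR (- (c * sqnorm x)).
  rewrite /heat_kernel powRN; congr ((_ `^ _)^-1 * expR (- _)).
    by field; rewrite gt_eqF.
  by field; rewrite gt_eqF.
under eq_integral do rewrite hE.
have me : measurable_fun setT (fun x : n.-tuple R => expR (- (c * sqnorm x))).
  apply: measurableT_comp => //; apply: measurable_funN.
  by apply: measurable_funM => //; exact: measurable_sqnorm.
rewrite ge0_integral_cstM//; last by rewrite invr_ge0 ltW.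
move=> H; rewrite -[RHS]mule1 -H muleA -EFinM mulfV ?gt_eqF// mul1e//.
Qed.

(** Subordination and Tonelli: integrating first in [x] produces $v^{-(n+1)}$, which cancels the
    weight $v^{n+1}$ and leaves a half-line Gaussian in [v]. *)
Let mixture n (t : R) : 0 < t ->
  (E_Gamma n * \int[lebesgue_tuple R n.+1]_x
     ((t ^+ 2 + sqnorm x) `^ (- (n.+2%:R / 2)))%:E =
   (pi `^ (n.+2%:R / 2) / t)%:E)%E.
Proof.
move=> t0.
(* The indicator of [D] puts the integrand on the whole line for Tonelli; [D] is open at 0 so that
   [v] can be inverted. *)
pose D := `]0%R, +oo[%classic : set R.
pose h (x : n.+1.-tuple R) (v : R) :=
  2 * v ^+ n.+1 * expR (- ((t ^+ 2 + sqnorm x) * v ^+ 2)) * \1_D v.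
have a0 (x : n.+1.-tuple R) : 0 < t ^+ 2 + sqnorm x.
  by rewrite ltr_wpDr ?sqnorm_ge0// exprn_gt0.
have mh : measurable_fun setT (fun p : n.+1.-tuple R * R => h p.1 p.2).
  apply: measurable_funM; last first.
    apply: (measurableT_comp (f := \1_D : R -> R)) => //.
    by apply: measurable_indic; exact: measurable_itv.
  apply: measurable_funM.
    apply: measurable_funM => //.
    by apply: measurable_funX; exact: measurable_snd.
  apply: measurableT_comp => //; apply: measurable_funN.
  apply: measurable_funM; last by apply: measurable_funX; exact: measurable_snd.
  apply: measurable_funD => //.
  by apply: (measurableT_comp (@measurable_sqnorm R n.+1)).
have h0 x v : 0 <= h x v.
  rewrite /h indicE; have [|] := boolP (v \in D); rewrite ?mulr0// mulr1.
  rewrite inE /D/= in_itv/= andbT => v0.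
  by rewrite !mulr_ge0 ?expR_ge0// exprn_ge0// ltW.
have E0 : (0 <= E_Gamma n)%E by apply: integral_ge0 => u _; rewrite lee_fin.
have mJ : measurable_fun setT (fun x : n.+1.-tuple R =>
    (t ^+ 2 + sqnorm x) `^ (- (n.+2%:R / 2))).
  apply: (measurableT_comp (measurable_powR _)).
  by apply: measurable_funD => //; exact: measurable_sqnorm.
rewrite -ge0_integralZl//; last 2 first.
- exact/measurable_EFinP.
- by move=> x _; rewrite lee_fin powR_ge0.
transitivity (\int[lebesgue_tuple R n.+1]_x \int[mu]_v (h x v)%:E)%E.
  apply: eq_integral => x _; rewrite subordination//.
  rewrite -integral_itv_obnd_cbnd; last first.
    apply/measurable_EFinP; apply: measurable_funTS; apply: measurable_funM.
      by apply: measurable_funM => //; exact: measurable_funX.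
    apply: measurableT_comp => //; apply: measurable_funN.
    by apply: measurable_funM => //; exact: measurable_funX.
  rewrite integral_mkcond; apply: eq_integral => v _.
  rewrite /patch /h indicE -/D; case: ifPn => _; first by rewrite mulr1.
  by rewrite mulr0.
rewrite (@fubini_tonelli _ _ _ _ _ (lebesgue_tuple R n.+1) mu
  (fun p => (h p.1 p.2)%:E))//; last 2 first.
- exact/measurable_EFinP.
- by move=> p; rewrite lee_fin.
transitivity (\int[mu]_(v in D)
  ((2 * pi `^ (n.+1%:R / 2)) * expR (- (t ^+ 2 * v ^+ 2)))%:E)%E.
  rewrite [RHS]integral_mkcond; apply: eq_integral => v _ /=.
  rewrite /fubini_G/= /patch /h indicE; case: ifPn => vD; last first.
    by under eq_integral do rewrite mulr0; rewrite integral0.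
  have v0 : 0 < v by move: vD; rewrite inE /D/= in_itv/= andbT.
  have c0 : 0 < v ^+ 2 by rewrite exprn_gt0.
  transitivity (\int[lebesgue_tuple R n.+1]_x
    (2 * v ^+ n.+1 * expR (- (t ^+ 2 * v ^+ 2)) *
     expR (- (v ^+ 2 * sqnorm x)))%:E)%E.
    apply: eq_integral => x _; rewrite mulr1; congr EFin.
    by rewrite -[RHS]mulrA -expRD; congr (_ * expR _); ring.
  have me : measurable_fun setT
      (fun x : n.+1.-tuple R => expR (- (v ^+ 2 * sqnorm x))).
    apply: measurableT_comp => //; apply: measurable_funN.
    by apply: measurable_funM => //; exact: measurable_sqnorm.
  rewrite ge0_integral_cstM//; last first.
    by apply: mulr_ge0 => //; apply: mulr_ge0 => //; rewrite exprn_ge0// ltW.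
  rewrite integral_gauss_tuple// -EFinM; congr EFin.
  have vn : (v ^+ 2)^-1 `^ (n.+1%:R / 2) = (v ^+ n.+1)^-1.
    rewrite -(@powR_inv1 _ (v ^+ 2)) ?sqr_ge0// -powRrM mulN1r powRN; congr _^-1.
    rewrite -(@powR_mulrn _ v 2) ?ltW// -powRrM -(@powR_mulrn _ v n.+1) ?ltW//.
    by congr (_ `^ _); field.
  have v2 : 0 <= (v ^+ 2)^-1 by rewrite invr_ge0 ltW.
  rewrite powRM ?pi_ge0// vn.
  by field; rewrite expf_neq0// gt_eqF.
rewrite /D integral_itv_obnd_cbnd; last first.
  apply/measurable_EFinP; apply: measurable_funTS; apply: measurable_funM => //.
  apply: measurableT_comp => //; apply: measurable_funN.
  by apply: measurable_funM => //; exact: measurable_funX.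
have me : measurable_fun (`[0%R, +oo[%classic : set R)
    (fun v : R => expR (- (t ^+ 2 * v ^+ 2))).
  apply: measurable_funTS; apply: measurableT_comp => //.
  apply: measurable_funN.
  by apply: measurable_funM => //; exact: measurable_funX.
rewrite ge0_integral_cstM//; last by rewrite mulr_ge0// powR_ge0.
rewrite integral0y_gauss_scale// -EFinM; congr EFin.
rewrite -powR12_sqrt ?pi_ge0//.
rewrite (_ : n.+2%:R / 2 = n.+1%:R / 2 + 2^-1); last by rewrite -!natr1; field.
rewrite powRD; last by rewrite (gt_eqF (pi_gt0 R)) implybT.
by field; rewrite gt_eqF.
Qed.

Lemma integral_poisson_kernel n (t : R) : 0 < t ->
  (\int[lebesgue_tuple R n.+1]_x (poisson_kernel t x)%:E = 1)%E.
Proof.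
move=> t0; have := mixture n t0; set J := integral _ _ _ => EJ.
have q0 : 0 < pi `^ (n.+2%:R / 2) / t :> R.
  by rewrite divr_gt0// powR_gt0// pi_gt0.
have J0 : (0 <= J)%E by apply: integral_ge0 => x _; rewrite lee_fin powR_ge0.
have E0 : (0 <= E_Gamma n)%E by apply: integral_ge0 => u _; rewrite lee_fin.
(* An infinite factor would make the product in [mixture] equal to 0 or $+\infty$, whereas it is
   positive and finite. *)
have Efin : E_Gamma n \is a fin_num.
  rewrite ge0_fin_numE// ltNge; apply/negP; rewrite leye_eq => /eqP Ey.
  move: EJ; rewrite Ey; have [->|Jn0] := eqVneq J 0%E.
    by rewrite mule0 => E; move: q0; rewrite -lte_fin -E ltxx.
  by rewrite gt0_mulye// lt0e Jn0.
have GJ : ((fine (E_Gamma n))%:E * J = (pi `^ (n.+2%:R / 2) / t)%:E)%E.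
  by rewrite fineK.
have mJ : measurable_fun setT (fun x : n.+1.-tuple R =>
    (t ^+ 2 + sqnorm x) `^ (- (n.+2%:R / 2))).
  apply: (measurableT_comp (measurable_powR _)).
  by apply: measurable_funD => //; exact: measurable_sqnorm.
rewrite /poisson_kernel GammaE.
under eq_integral do rewrite mulrA.
have p0 (a b : R) : 0 <= a `^ b := powR_ge0 _ _.
rewrite ge0_integral_cstM//; last first.
  by apply: mulr_ge0; [apply: mulr_ge0 => //; exact: fine_ge0|exact: ltW].
rewrite -/J -mulrA mulrC EFinM -muleA GJ -EFinM; congr EFin.
rewrite powRN; have : pi `^ (n.+2%:R / 2) != 0 :> R.
  by rewrite gt_eqF// powR_gt0// pi_gt0.
by move=> pn0; field; rewrite pn0 gt_eqF.
Qed.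

Lemma Gamma_ge0 (s : R) : 0 <= Gamma s.
Proof.
by apply: Rintegral_ge0 => x _; rewrite mulr_ge0 ?powR_ge0 ?expR_ge0.
Qed.

Lemma poisson_kernel_ge0 n (t : R) x : 0 < t -> 0 <= @poisson_kernel R n t x.
Proof.
move=> /ltW t0.
by apply: mulr_ge0; apply: mulr_ge0; rewrite ?Gamma_ge0 ?powR_ge0.
Qed.

Lemma prob_poisson_kernel n (t : R) : 0 < t ->
  prob_kernel (@poisson_kernel R n.+1 t).
Proof.
move=> t0; split; [|exact: measurable_poisson_kernel|].
  by move=> x; exact: poisson_kernel_ge0.
exact: integral_poisson_kernel.
Qed.

Lemma powRN_le (A B c q : R) : 0 < A -> 0 < B -> 0 < c -> 0 <= q ->
  B <= c * A -> A `^ (- q) <= c `^ q * B `^ (- q).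
Proof.
move=> A0 B0 c0 q0 BcA; rewrite !powRN.
rewrite ler_pdivlMr ?powR_gt0// mulrC ler_pdivrMr ?powR_gt0//.
have cA : 0 < c * A by exact: mulr_gt0.
rewrite -powRM; [|exact: ltW|exact: ltW].
by apply: ge0_ler_powR => //; rewrite nnegrE ltW.
Qed.

(** Bernoulli in place of a derivative: $1-e\le A/B\le 1$ gives $(A/B)^q\ge(A/B)^m\ge 1-me$, the
    integer [m] allowing an induction. *)
Lemma powRN_diff_le (A B q e : R) (m : nat) : 0 < A -> A <= B -> 0 <= e ->
  0 <= q <= m%:R -> B - A <= e * B ->
  A `^ (- q) - B `^ (- q) <= m%:R * e * A `^ (- q).
Proof.
move=> A0 AB e0 /andP[q0 qm] H.
have B0 : 0 < B by apply: lt_le_trans AB.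
have r0 : 0 < A / B by rewrite divr_gt0.
have r1 : A / B <= 1 by rewrite ler_pdivrMr// mul1r.
have re : 1 - e <= A / B by rewrite ler_pdivlMr//; lra.
have bern : forall k : nat, 1 - k%:R * e <= (A / B) ^+ k.
  elim=> [|k IH]; first by rewrite mul0r subr0 expr0.
  have rk : (A / B) ^+ k <= 1 by rewrite exprn_ile1// ltW.
  have : (1 - A / B) * (A / B) ^+ k <= e * 1.
    by apply: ler_pM; rewrite ?subr_ge0 ?exprn_ge0//; [exact: ltW|lra].
  rewrite exprS -natr1; lra.
have -> : B `^ (- q) = (A / B) `^ q * A `^ (- q).
  have -> : (A / B) `^ q = A `^ q / B `^ q.
    have B1 : 0 <= B^-1 by rewrite invr_ge0 ltW.
    rewrite powRM//; last exact: ltW.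
    by rewrite -(@powR_inv1 _ B) ?ltW// -powRrM mulN1r powRN.
  by rewrite !powRN mulrAC mulfV ?mul1r// gt_eqF// powR_gt0.
have : 1 - m%:R * e <= (A / B) `^ q.
  apply: le_trans (bern m) _; rewrite -powR_mulrn; last exact: ltW.
  by apply: ger_powR => //; rewrite r0.
move=> h; have := ler_wpM2r (powR_ge0 A (- q)) h; lra.
Qed.

(** Lengths scale like [t] itself, so a displacement [t] at scale $2^jt$ gives [theta] $=1/2$. The 6
    comes from $(2t)^2+|y|^2\le 6(t^2+|x|^2)$ for $|x-y|\le t$; $2(n+2)$ comes from [powRN_diff_le]
    with parameter [2 * e] and the integer $n+2$ above the exponent. *)
Lemma dyadic_poisson_kernel n : dyadic_kernel (@poisson_kernel R n.+1)
  (fun t => t ^+ 2) (2 * n.+2%:R * 6 `^ (n.+2%:R / 2)) 2^-1.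
Proof.
set q : R := n.+2%:R / 2.
have q0 : 0 <= q by rewrite divr_ge0.
have n2 : 2 <= n.+2%:R :> R by rewrite ler_nat.
have P1 : 1 <= 6 `^ q :> R by rewrite -[leLHS](powRr0 6) ler_powR// ler1n.
have P0 : 0 <= 6 `^ q :> R by apply: le_trans P1.
set G := Gamma q * pi `^ (- q).
have G0 : 0 <= G by rewrite mulr_ge0 ?Gamma_ge0 ?powR_ge0.
have pE (t : R) (x : n.+1.-tuple R) :
    poisson_kernel t x = G * t * (t ^+ 2 + sqnorm x) `^ (- q).
  by rewrite /poisson_kernel -/q -/G mulrA.
have a0 (t : R) (x : n.+1.-tuple R) : 0 < t -> 0 < t ^+ 2 + sqnorm x.
  by move=> t0; rewrite ltr_wpDr ?sqnorm_ge0// exprn_gt0.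
have harnack (t : R) (x y : n.+1.-tuple R) : 0 < t ->
    sqnorm (tuple_sub x y) <= t ^+ 2 ->
    poisson_kernel t x <= 6 `^ q * poisson_kernel (2 * t) y.
  move=> t0 xy; rewrite !pE.
  have B0 := a0 _ y (mulr_gt0 (ltr0n R 2) t0).
  have := @powRN_le _ _ 6 q (a0 _ x t0) B0 (ltr0n _ _) q0.
  set A := (t ^+ 2 + _) `^ _; set B := ((2 * t) ^+ 2 + _) `^ _ => H.
  have {}H : A <= 6 `^ q * B.
    apply: H; have := sqnorm_le2 x y; have := sqnorm_ge0 x.
    by rewrite exprMn; have := sqr_ge0 t; lra.
  apply: (@le_trans _ _ (G * t * (6 `^ q * B))).
    by rewrite ler_wpM2l// mulr_ge0// ltW.
  have : 0 <= G * t * (6 `^ q * B).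
    by apply: mulr_ge0; apply: mulr_ge0 => //; [exact: ltW|exact: powR_ge0].
  lra.
have CP : 6 `^ q <= 2 * n.+2%:R * 6 `^ q by rewrite ler_peMl//; lra.
have h01 := half_itv R.
split=> //.
- exact: le_trans CP.
- exact: prob_poisson_kernel.
- by move=> t t0; rewrite exprn_gt0.
- move=> t D t0; have [m Hm] := exists_pow2_ge D (exprn_gt0 2 t0).
  exists m; apply: le_trans Hm _.
  rewrite exprMn ler_wpM2r ?sqr_ge0// expr2 ler_peMl ?exprn_ge0//.
  by rewrite exprn_ege1// ler1n.
- move=> t x y t0 xy; apply: le_trans (harnack t x y t0 xy) _.
  by rewrite ler_wpM2r//; apply: poisson_kernel_ge0; rewrite mulr_gt0.
- move=> t x y j t0 xy.
  set s := 2 ^+ j * t; have s0 : 0 < s by rewrite mulr_gt0// exprn_gt0.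
  have -> : 2 ^+ j.+1 * t = 2 * s by rewrite exprS mulrA.
  have s20 : 0 < 2 * s by rewrite mulr_gt0.
  set e := 2^-1 ^+ j.
  have e0 : 0 < e by rewrite exprn_gt0// invr_gt0.
  have es : e ^+ 2 * s ^+ 2 = t ^+ 2.
    by rewrite -exprMn /e /s mulrA -exprMn mulVf// expr1n mul1r.
  suff H (x' y' : n.+1.-tuple R) : sqnorm (tuple_sub x' y') <= t ^+ 2 ->
      poisson_kernel s x' - poisson_kernel s y' <=
      2 * n.+2%:R * e * poisson_kernel s x'.
    have H' (x' y' : n.+1.-tuple R) : sqnorm (tuple_sub x' y') <= t ^+ 2 ->
        poisson_kernel s x' - poisson_kernel s y' <=
        2 * n.+2%:R * 6 `^ q * e *
          (poisson_kernel (2 * s) x' + poisson_kernel (2 * s) y').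
      move=> /H /le_trans; apply.
      have := harnack s x' x' s0; rewrite sqnorm_sub0 => /(_ (sqr_ge0 _)) h.
      have c0 : 0 <= 2 * n.+2%:R * e by rewrite mulr_ge0// ltW.
      have py := @poisson_kernel_ge0 n.+1 (2 * s) y' s20.
      apply: le_trans (ler_wpM2l c0 h) _.
      rewrite (_ : 2 * n.+2%:R * 6 `^ q * e * _ = 2 * n.+2%:R * e *
        (6 `^ q * (poisson_kernel (2 * s) x' + poisson_kernel (2 * s) y'))).
        by rewrite ler_wpM2l// ler_wpM2l// lerDl.
      by ring.
    rewrite ler_norml lerNl opprB; apply/andP; split; last exact: H'.
    by rewrite [X in _ <= _ * X]addrC; apply: H'; rewrite sqnorm_subC.
  move=> {x y xy}; move: x' y' => x y xy.
  (* The kernel decreases with the norm, so if [y] is the closer point to the origin the difference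
     is at most 0. *)
  have [xly|ylx] := leP (sqnorm x) (sqnorm y); last first.
    have c0 : 0 <= 2 * n.+2%:R * e * poisson_kernel s x.
      by rewrite mulr_ge0 ?poisson_kernel_ge0// mulr_ge0// ltW.
    apply: le_trans c0; rewrite subr_le0 !pE.
    apply: ler_wpM2l; first by rewrite mulr_ge0// ltW.
    rewrite !powRN lef_pV2 ?posrE ?powR_gt0 ?a0//.
    apply: ge0_ler_powR => //; rewrite ?nnegrE.
    - by rewrite ltW// a0.
    - by rewrite ltW// a0.
    - by rewrite lerD2l ltW.
  have xy' : sqnorm y - sqnorm x <= e * (s ^+ 2 / 2 + sqnorm x + sqnorm y).
    by apply: sqnorm_sub_le => //; rewrite es.
  have qm : 0 <= q <= n.+2%:R by rewrite q0 /q; lra.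
  have := @powRN_diff_le (s ^+ 2 + sqnorm x) (s ^+ 2 + sqnorm y) q (2 * e) n.+2
    (a0 s x s0).
  rewrite lerD2l => /(_ xly) /(_ (mulr_ge0 (ler0n _ _) (ltW e0))) /(_ qm) H.
  rewrite !pE -mulrBr.
  have {}H : (s ^+ 2 + sqnorm x) `^ (- q) - (s ^+ 2 + sqnorm y) `^ (- q) <=
      n.+2%:R * (2 * e) * (s ^+ 2 + sqnorm x) `^ (- q).
    apply: H; rewrite opprD addrACA subrr add0r; apply: le_trans xy' _.
    rewrite (_ : 2 * e * _ = e * (2 * (s ^+ 2 + sqnorm y))); last by ring.
    by rewrite ler_pM2l//; have := sqr_ge0 s; lra.
  have Gs : 0 <= G * s by rewrite mulr_ge0// ltW.
  apply: le_trans (ler_wpM2l Gs H) _.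
  by rewrite le_eqVlt; apply/orP; left; apply/eqP; ring.
(* Beyond radius [s] the powers at scales [t] and [s] are comparable, so the decay is exactly the
   ratio $t/s=2^{-j}$ of the prefactors. *)
- move=> t j t0; exists (2 ^+ j * t); first by rewrite mulr_gt0// exprn_gt0.
  set s := 2 ^+ j * t => z zt.
  have s0 : 0 < s by rewrite mulr_gt0// exprn_gt0.
  have jE : 2^-1 ^+ j * s = t by rewrite /s mulrA -exprMn mulVf// expr1n mul1r.
  rewrite !pE.
  have := @powRN_le _ _ 6 q (a0 _ z t0) (a0 _ z s0) (ltr0n _ _) q0.
  have h6 : s ^+ 2 + sqnorm z <= 6 * (t ^+ 2 + sqnorm z).
    by have := sqr_ge0 t; have := sqnorm_ge0 z; lra.
  move=> /(_ h6) H; have Gt : 0 <= G * t by rewrite mulr_ge0// ltW.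
  apply: le_trans (ler_wpM2l Gt H) _.
  rewrite (_ : _ * (G * s * _) = 2 * n.+2%:R * 6 `^ q *
    (G * t * (s ^+ 2 + sqnorm z) `^ (- q))); last by rewrite -[in RHS]jE; ring.
  rewrite mulrCA ler_wpM2r//; apply: mulr_ge0 => //; exact: powR_ge0.
Qed.

End poisson_kernel.

(** * Norms *)

Section essential_bounds.
Context (R : realType) (n : nat).
Local Notation Rn := (n.-tuple R).
Local Notation leb := (lebesgue_tuple R n).
Local Notation bm := bounded_measurable.
Local Notation dist x y := (sqnorm (tuple_sub x y)).
Implicit Types (q : Rn -> R) (f : Rn -> R[i]).

Lemma Linfty_normE f :
  Linfty_norm f = ess_sup leb (fun x => (Normc.normc (f x))%:E).
Proof.
rewrite /Linfty_norm unlock ifT ?lebesgue_tupleT_gt0//; congr ess_sup.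
by apply/funext => x /=; rewrite ger0_norm// /Normc.normc; case: (f x).
Qed.

Lemma Linfty_norm_ge0 f : (0 <= Linfty_norm f)%E.
Proof. exact: Lnorm_ge0. Qed.

Lemma Linfty_norm_le f (c : R) : (forall x, Normc.normc (f x) <= c) ->
  (Linfty_norm f <= c%:E)%E.
Proof.
move=> fc; rewrite Linfty_normE; apply/ess_supP.
by apply/nearW => x; rewrite lee_fin.
Qed.

Definition unif_cont q := forall e, 0 < e ->
  exists2 d, 0 < d & forall x y, dist x y < d -> `|q x - q y| <= e.

Lemma unif_contD q1 q2 : unif_cont q1 -> unif_cont q2 ->
  unif_cont (fun x => q1 x + q2 x).
Proof.
move=> c1 c2 e e0; have e2 : 0 < e / 2 by rewrite divr_gt0.
have [d1 d10 H1] := c1 _ e2; have [d2 d20 H2] := c2 _ e2.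
exists (Num.min d1 d2); first by rewrite lt_min d10.
move=> x y; rewrite lt_min => /andP[/H1 h1 /H2 h2].
rewrite (_ : _ - _ = (q1 x - q1 y) + (q2 x - q2 y)); last by ring.
by rewrite (le_trans (ler_normD _ _))//; lra.
Qed.

Lemma unif_contN q : unif_cont q -> unif_cont (fun x => - q x).
Proof.
move=> c e /c[d d0 H]; exists d => // x y /H.
by rewrite -opprD normrN.
Qed.

Lemma unif_cont_sqr q : unif_cont q -> bm q ->
  unif_cont (fun x => q x ^+ 2).
Proof.
move=> c /bm_bound[B B0 qB] e e0.
have B1 : 0 < 2 * B + 1 by rewrite ltr_wpDl// mulr_ge0.
have [d d0 H] := c _ (divr_gt0 e0 B1); exists d => // x y /H h.
rewrite subr_sqr normrM.
apply: (@le_trans _ _ (e / (2 * B + 1) * (2 * B + 1))).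
  apply: ler_pM => //; rewrite (le_trans (ler_normD _ _))//.
  by have := qB x; have := qB y; lra.
by rewrite divfK// gt_eqF.
Qed.

(* A bound on the essential supremum of a continuous function holds everywhere,
   since balls have positive measure. *)
Lemma Linfty_norm_ge q (c : R) : unif_cont q ->
  (Linfty_norm (fun x => Complex (q x) 0%R) <= c%:E)%E -> forall x, q x <= c.
Proof.
move=> qc; rewrite Linfty_normE => /ess_supP[N [mN N0 sub]] x.
rewrite leNgt; apply/negP => cq.
have e0 : 0 < (q x - c) / 2 by rewrite divr_gt0// subr_gt0.
have [d d0 Hd] := qc _ e0.
have := lebesgue_tuple_ball_gt0 x d0.
suff -> : leb [set y | dist x y < d] = 0%E by rewrite ltxx.
apply: (subset_measure0 _ mN _ N0).
  exact: measurable_sqnorm_ball.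
move=> y /= xy; apply: sub => /=; rewrite lee_fin; apply/negP; rewrite -ltNge.
rewrite expr0n addr0 sqrtr_sqr; have := Hd _ _ xy; rewrite ler_norml => /andP[_ h].
by apply: lt_le_trans (ler_norm _); lra.
Qed.

(** Clipping both parts at the essential bound changes them only on a null set, which no average
    detects, and makes them bounded everywhere. *)
Lemma Linfty_clip f : Linfty f -> exists u v : Rn -> R,
  [/\ bm u, bm v, (\forall y \ae leb, u y = complex.Re (f y)) &
      (\forall y \ae leb, v y = complex.Im (f y))].
Proof.
case=> mu mv; have := Linfty_norm_ge0 f; rewrite Linfty_normE.
case E : ess_sup => [B| |]//; rewrite lee_fin => B0 _.
have /ess_supP H : (ess_sup leb (fun x => (Normc.normc (f x))%:E) <= B%:E)%E.
  by rewrite E.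
pose clip (w : Rn -> R) y := Num.max (- B) (Num.min B (w y)).
have bclip w : measurable_fun setT w -> bm (clip w).
  move=> mw; split.
    apply: measurable_maxr; first exact: measurable_cst.
    by apply: measurable_minr => //; exact: measurable_cst.
  exists B => y; rewrite ler_norml /clip le_max lexx/= ge_max.
  by rewrite ge_min lexx/= andbT; lra.
have clipE (w : Rn -> R) y : `|w y| <= B -> clip w y = w y.
  by rewrite ler_norml => /andP[h1 h2]; rewrite /clip min_r// max_r.
have le_normc (z : R[i]) : `|complex.Re z| <= Normc.normc z /\
    `|complex.Im z| <= Normc.normc z.
  by case: z => a b /=; rewrite -!sqrtr_sqr !ler_sqrt ?addr_ge0 ?sqr_ge0//;
    rewrite lerDl lerDr !sqr_ge0.
exists (clip (fun y => complex.Re (f y))), (clip (fun y => complex.Im (f y))).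
split; [exact: bclip|exact: bclip| |].
- apply: filterS H => y; rewrite lee_fin => fy; rewrite clipE//.
  by apply: le_trans fy; exact: (le_normc _).1.
- apply: filterS H => y; rewrite lee_fin => fy; rewrite clipE//.
  by apply: le_trans fy; exact: (le_normc _).2.
Qed.

End essential_bounds.

(** * Reducing the norms to bounds at each scale *)

Section transfer.
Context (R : realType).

Lemma scaled_root_le (p M : R) (L : \bar R) : 0 < p -> 0 <= M -> (0 <= L)%E ->
  ((p^-1)%:E * L `^ 2^-1 <= M%:E)%E = (L <= ((M * p) ^+ 2)%:E)%E.
Proof.
move=> p0 M0; case: L => [l| |]// l0; last first.
  have -> : (+oo `^ 2^-1 = +oo :> \bar R)%E by rewrite poweRyr// invr_eq0.
  by rewrite gt0_muley ?lte_fin ?invr_gt0// !leye_eq.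
rewrite lee_fin in l0.
have Mp : 0 <= p * M by rewrite mulr_ge0// ltW.
rewrite poweR_EFin -EFinM !lee_fin ler_pdivrMl// powR12_sqrt//.
have := @ler_sqr R (Num.sqrt l) (p * M).
by rewrite !nnegrE sqrtr_ge0 Mp sqr_sqrtr// mulrC => /(_ isT isT) ->.
Qed.

Variables (n : nat) (alpha : R).
Local Notation Rn := (n.-tuple R).

(** The common shape of the second summands of [ell_norm] and [calL_norm]. *)
Definition scaled_sup (F : R -> Rn -> R[i]) : \bar R :=
  ereal_sup [set ((t `^ alpha)^-1)%:E * (Linfty_norm (F t)) `^ 2^-1
    | t in [set t : R | (0 < t)%R]]%E.

Lemma scaled_sup_ge0 F : (0 <= scaled_sup F)%E.
Proof.
apply: (@le_trans _ _
  (((1%R `^ alpha)^-1)%:E * (Linfty_norm (F 1%R)) `^ 2^-1)%E).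
  by rewrite mule_ge0 ?poweR_ge0// lee_fin invr_ge0 powR_ge0.
by apply: ereal_sup_ubound; exists 1 => //=; exact: ltr01.
Qed.

Lemma scaled_sup_le F (M : R) : 0 <= M ->
  (scaled_sup F <= M%:E)%E <->
  forall t, 0 < t -> (Linfty_norm (F t) <= ((M * t `^ alpha) ^+ 2)%:E)%E.
Proof.
move=> M0; split.
  move=> H t t0; rewrite -scaled_root_le ?powR_gt0 ?Linfty_norm_ge0//.
  by apply: le_trans H; apply: ereal_sup_ubound; exists t.
move=> H; apply: ge_ereal_sup => _ [t /= t0 <-].
by rewrite scaled_root_le ?powR_gt0 ?Linfty_norm_ge0//; exact: H.
Qed.

(** A finite supremum is itself an admissible [M]; if it is infinite, the bound is trivial because
    [c] is positive. *)
Lemma scaled_sup_transfer F G (c : R) : 0 < c ->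
  (forall M, 0 <= M ->
    (forall t, 0 < t -> (Linfty_norm (F t) <= ((M * t `^ alpha) ^+ 2)%:E)%E) ->
    forall t, 0 < t -> (Linfty_norm (G t) <= ((c * M * t `^ alpha) ^+ 2)%:E)%E) ->
  (scaled_sup G <= c%:E * scaled_sup F)%E.
Proof.
move=> c0 H; have := scaled_sup_ge0 F; case E : (scaled_sup F) => [M| |]// M0.
  rewrite -EFinM scaled_sup_le ?mulr_ge0// ?ltW//.
  by apply: H => //; apply/scaled_sup_le => //; rewrite E.
by rewrite gt0_muley// leey.
Qed.

End transfer.

(** * Equivalence of the two norms for a dyadic kernel *)

Section dyadic_semigroup.
Context (R : realType) (n : nat) (alpha : R).
Local Notation Rn := (n.-tuple R).
Local Notation leb := (lebesgue_tuple R n).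
Local Notation bm := bounded_measurable.
Local Notation dist x y := (sqnorm (tuple_sub x y)).
Variables (k : R -> Rn -> R) (rad : R -> R) (C theta : R).
Hypothesis K : dyadic_kernel k rad C theta.
Hypotheses (lam1 : 1 < 2 `^ alpha) (lam2 : (2 `^ alpha) ^+ 2 < 2)
  (lamth : theta * 2 `^ alpha < 1).

Let kP t : 0 < t -> prob_kernel (k t) := @dk_prob _ _ _ _ _ _ K t.

(** View [t] as [2 ^+ j * s] with [s] tiny: a displacement within the radius of [s] changes the
    average by at most $2C\theta^jB$. *)
Lemma unif_cont_avg t g : 0 < t -> bm g -> unif_cont (fun x => avg (k t) x g).
Proof.
move=> t0 bg e e0; have [B B0 gB] := bm_bound bg.
have C0 : 0 <= C by apply: le_trans (dk_const K).
have cB : 0 < 2 * C * B + 1 by rewrite ltr_wpDl// mulr_ge0// mulr_ge0.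
have [j Hj] := exp_small (dk_theta K) (divr_gt0 e0 cB).
pose s := 2^-1 ^+ j * t.
have s0 : 0 < s by rewrite mulr_gt0// exprn_gt0// invr_gt0.
have st : 2 ^+ j * s = t by rewrite /s mulrA -exprMn mulfV// expr1n mul1r.
exists (rad s); first exact: (dk_rad K).
move=> x y /ltW xy; have := avg_modulus K j s0 xy bg gB; rewrite st => h.
apply: le_trans h _; move: Hj; rewrite ltr_pdivlMr// => /ltW.
have : 0 <= theta ^+ j by rewrite exprn_ge0//; case/andP: (dk_theta K).
lra.
Qed.

Let T t := convolution (k t).

Lemma avg_ae t x (g h : Rn -> R) : 0 < t -> measurable_fun setT g ->
  measurable_fun setT h -> (\forall y \ae leb, g y = h y) ->
  avg (k t) x g = avg (k t) x h.
Proof.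
move=> t0 mg mh gh; rewrite /avg /Rintegral; congr fine.
have mk := measurable_kernel_sub x (kP t0).
apply: ae_eq_integral => //.
- by apply/measurable_EFinP; exact: measurable_funM.
- by apply/measurable_EFinP; exact: measurable_funM.
- by apply: filterS gh => y -> _.
Qed.

Lemma avg0 t x : avg (k t) x (fun=> 0) = 0.
Proof.
rewrite /avg /Rintegral; under eq_integral do rewrite mulr0.
by rewrite integral0.
Qed.

Lemma convolution_sqr t x (g : Rn -> R[i]) :
  T t (fun y => `|g y| ^+ 2) x =
  Complex (avg (k t) x (fun y => complex.Re (g y) ^+ 2 + complex.Im (g y) ^+ 2))
    0.
Proof.
rewrite /T /convolution; congr Complex.
  by apply: eq_Rintegral => y _; rewrite -add_Re2_Im2.
rewrite -[RHS](avg0 t x); apply: eq_Rintegral => y _.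
by rewrite -add_Re2_Im2.
Qed.

Section real_parts.
Variables (f : Rn -> R[i]) (u v : Rn -> R).
Hypotheses (Lf : Linfty f) (bu : bm u) (bv : bm v).
Hypotheses (uf : \forall y \ae leb, u y = complex.Re (f y))
  (vf : \forall y \ae leb, v y = complex.Im (f y)).

Let mRe : measurable_fun setT (fun y => complex.Re (f y)).
Proof. by case: Lf. Qed.
Let mIm : measurable_fun setT (fun y => complex.Im (f y)).
Proof. by case: Lf. Qed.

Let U t x := avg (k t) x u.
Let V t x := avg (k t) x v.

Lemma convolutionE t x : 0 < t -> T t f x = Complex (U t x) (V t x).
Proof.
move=> t0; rewrite /T /convolution /U /V.
congr Complex.
  rewrite -/(avg (k t) x (fun y => complex.Re (f y))).
  by apply/esym/avg_ae => //; case: bu.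
rewrite -/(avg (k t) x (fun y => complex.Im (f y))).
by apply/esym/avg_ae => //; case: bv.
Qed.

Definition variance t x :=
  avg (k t) x (fun y => (u y - U t x) ^+ 2) +
  avg (k t) x (fun y => (v y - V t x) ^+ 2).

Definition dispersion t x :=
  avg (k t) x (fun y => (u y - U t y) ^+ 2) +
  avg (k t) x (fun y => (v y - V t y) ^+ 2).

Lemma ell_integrandE t x : 0 < t ->
  T t (fun y => `|f y| ^+ 2) x - `|T t f x| ^+ 2 = Complex (variance t x) 0.
Proof.
move=> t0; have kt := kP t0; rewrite convolutionE// convolution_sqr.
rewrite -add_Re2_Im2; apply/eqP; rewrite eq_complex /= subr0 eqxx andbT.
rewrite /variance !avg_sqrB// -/(U t x) -/(V t x).
have -> : avg (k t) x (fun y => complex.Re (f y) ^+ 2 + complex.Im (f y) ^+ 2) =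
    avg (k t) x (fun y => u y ^+ 2 + v y ^+ 2).
  apply: avg_ae => //.
  - by apply: measurable_funD; exact: measurable_funX.
  - by case: (bmD (bm_sqr bu) (bm_sqr bv)).
  - by apply: filterS2 uf vf => y -> ->.
rewrite avgD//; try by bm.
by apply/eqP; ring.
Qed.

Lemma calL_integrandE t x : 0 < t ->
  T t (fun y => `|f y - T t f y| ^+ 2) x = Complex (dispersion t x) 0.
Proof.
move=> t0; have kt := kP t0; rewrite convolution_sqr; congr Complex.
have bU : bm (U t) by exact: bm_avg.
have bV : bm (V t) by exact: bm_avg.
have mU := bU.1; have mV := bV.1.
have ReE y : complex.Re (f y - T t f y) = complex.Re (f y) - U t y.
  by rewrite convolutionE//; case: (f y).
have ImE y : complex.Im (f y - T t f y) = complex.Im (f y) - V t y.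
  by rewrite convolutionE//; case: (f y).
rewrite /dispersion -avgD//; try by bm.
apply: avg_ae => //.
- under eq_fun do rewrite ReE ImE.
  by apply: measurable_funD; apply: measurable_funX; exact: measurable_funB.
- by case: (bmD (bm_sqr (bmB bu bU)) (bm_sqr (bmB bv bV))).
- by apply: filterS2 uf vf => y; rewrite ReE ImE => -> ->.
Qed.

Lemma unif_cont_variance t : 0 < t -> unif_cont (variance t).
Proof.
move=> t0; have kt := kP t0.
have aux w : bm w ->
    unif_cont (fun x => avg (k t) x (fun y => (w y - avg (k t) x w) ^+ 2)).
  move=> bw.
  rewrite (_ : (fun x => _) = (fun x => avg (k t) x (fun y => w y ^+ 2) +
    - avg (k t) x w ^+ 2)).
    apply: unif_contD; first by apply: unif_cont_avg => //; bm.
    apply: unif_contN; apply: unif_cont_sqr; last exact: bm_avg.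
    exact: unif_cont_avg.
  by apply/funext => x; rewrite avg_sqrB//; ring.
by apply: unif_contD; exact: aux.
Qed.

Lemma unif_cont_dispersion t : 0 < t -> unif_cont (dispersion t).
Proof.
move=> t0; have kt := kP t0.
have bU : bm (U t) by exact: bm_avg.
have bV : bm (V t) by exact: bm_avg.
by apply: unif_contD; apply: unif_cont_avg => //; bm.
Qed.

End real_parts.

Let ellF (f : Rn -> R[i]) t : Rn -> R[i] :=
  fun x => T t (fun y => `|f y| ^+ 2) x - `|T t f x| ^+ 2.
Let calF (f : Rn -> R[i]) t : Rn -> R[i] := T t (fun y => `|f y - T t f y| ^+ 2).

Let ell_calL : exists2 c, 0 < c & forall f, Linfty f ->
  (scaled_sup alpha (calF f) <= c%:E * scaled_sup alpha (ellF f))%E /\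
  (scaled_sup alpha (ellF f) <= c%:E * scaled_sup alpha (calF f))%E.
Proof.
have [c c0 H] := variance_dispersion_equiv K lam1 lam2 lamth.
(* The real and imaginary parts contribute $(cM)^2$ each, and $2(cM)^2\le(2cM)^2$. *)
exists (2 * c); first by rewrite mulr_gt0.
move=> f Lf; have [u [v [bu bv uf vf]]] := Linfty_clip Lf.
have ellE t : 0 < t -> ellF f t = fun x => Complex (variance u v t x) 0.
  by move=> t0; apply/funext => x; exact: (ell_integrandE Lf bu bv uf vf).
have calE t : 0 < t -> calF f t = fun x => Complex (dispersion u v t x) 0.
  by move=> t0; apply/funext => x; exact: (calL_integrandE Lf bu bv uf vf).
have normc_real (a : R) : 0 <= a -> Normc.normc (Complex a 0) = a.
  by move=> a0; rewrite /= expr0n addr0 sqrtr_sqr ger0_norm.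
have vu0 (w : Rn -> R) t x : 0 < t ->
    0 <= avg (k t) x (fun y => (w y - avg (k t) x w) ^+ 2).
  by move=> t0; apply: avg_ge0 => [|y]; [exact: kP|exact: sqr_ge0].
have du0 (w : Rn -> R) t x : 0 < t ->
    0 <= avg (k t) x (fun y => (w y - avg (k t) y w) ^+ 2).
  by move=> t0; apply: avg_ge0 => [|y]; [exact: kP|exact: sqr_ge0].
have c20 : 0 < 2 * c by rewrite mulr_gt0.
have NM M : 0 <= M -> (forall t, 0 < t -> 0 <= M * t `^ alpha) /\
    (forall t, 0 < t -> M * (2 * t) `^ alpha = 2 `^ alpha * (M * t `^ alpha)).
  move=> M0; split=> t t0; first by rewrite mulr_ge0// powR_ge0.
  by rewrite powRM ?ltW//; ring.
have double (a b M : R) : a <= (c * M) ^+ 2 -> b <= (c * M) ^+ 2 ->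
    a + b <= (2 * c * M) ^+ 2.
  by have := sqr_ge0 (c * M); rewrite -mulrA (exprMn 2); lra.
split; apply: scaled_sup_transfer => // M M0 HM t t0;
  have [N0 N2] := NM M M0.
- rewrite calE//; apply: Linfty_norm_le => x.
  rewrite normc_real ?addr_ge0 ?du0// -mulrA.
  (* Uniform continuity makes the essential bound valid everywhere; each of the two nonnegative
     parts then inherits it. *)
  have Hv s y : 0 < s -> variance u v s y <= (M * s `^ alpha) ^+ 2.
    move=> s0; apply: Linfty_norm_ge; first exact: unif_cont_variance.
    by rewrite -ellE//; exact: HM.
  apply: double.
    apply: (H _ u N0 N2 bu).1 => // s y s0; apply: le_trans (Hv s y s0).
    by rewrite lerDl vu0.
  apply: (H _ v N0 N2 bv).1 => // s y s0; apply: le_trans (Hv s y s0).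
  by rewrite lerDr vu0.
- rewrite ellE//; apply: Linfty_norm_le => x.
  rewrite normc_real ?addr_ge0 ?vu0// -mulrA.
  have Hd s y : 0 < s -> dispersion u v s y <= (M * s `^ alpha) ^+ 2.
    move=> s0; apply: Linfty_norm_ge; first exact: unif_cont_dispersion.
    by rewrite -calE//; exact: HM.
  apply: double.
    apply: (H _ u N0 N2 bu).2 => // s y s0; apply: le_trans (Hd s y s0).
    by rewrite lerDl du0.
  apply: (H _ v N0 N2 bv).2 => // s y s0; apply: le_trans (Hd s y s0).
  by rewrite lerDr du0.
Qed.

Theorem dyadic_semigroup_equiv : coincide_with_equivalent_norms
  (ell_space T alpha) (calL_space T alpha)
  (ell_norm T alpha) (calL_norm T alpha).
Proof.
have [c c0 H] := ell_calL.
have c10 : 0 < 1 + c by rewrite addr_gt0.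
have add_le (a x y : \bar R) : (0 <= a)%E -> (0 <= x)%E -> (y <= c%:E * x)%E ->
    (a + y <= (1 + c)%:E * (a + x))%E.
  move=> a0 x0 yx; rewrite ge0_muleDr//; apply: leeD.
    by rewrite -[leLHS]mul1e lee_wpmul2r// lee_fin lerDl ltW.
  by apply: le_trans yx _; rewrite lee_wpmul2r// lee_fin lerDr.
have le1 f : Linfty f ->
    (calL_norm T alpha f <= (1 + c)%:E * ell_norm T alpha f)%E.
  move=> Lf; apply: add_le; [exact: Linfty_norm_ge0|exact: scaled_sup_ge0|].
  exact: (H f Lf).1.
have le2 f : Linfty f ->
    (ell_norm T alpha f <= (1 + c)%:E * calL_norm T alpha f)%E.
  move=> Lf; apply: add_le; [exact: Linfty_norm_ge0|exact: scaled_sup_ge0|].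
  exact: (H f Lf).2.
have fin (a b : \bar R) : (0 <= b)%E -> (a <= (1 + c)%:E * b)%E ->
    (b < +oo)%E -> (a < +oo)%E.
  by case: b => // b _ h _; apply: le_lt_trans h _; rewrite -EFinM ltry.
have n1 f : (0 <= ell_norm T alpha f)%E.
  by rewrite adde_ge0 ?Linfty_norm_ge0//; exact: scaled_sup_ge0.
have n2 f : (0 <= calL_norm T alpha f)%E.
  by rewrite adde_ge0 ?Linfty_norm_ge0//; exact: scaled_sup_ge0.
split.
  apply/seteqP; split=> f [Lf nf]; split=> //.
    by apply: fin nf => //; exact: le1.
  by apply: fin nf => //; exact: le2.
exists (1 + c)^-1, (1 + c); split=> //; first by rewrite invr_gt0.
move=> f [Lf nf]; rewrite le1// andbT.
by rewrite lee_pdivrMl// le2.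
Qed.

End dyadic_semigroup.

Theorem propositionA3 (R : realType) (n : nat) (alpha : R) :
  (0 < n)%N -> 0 < alpha -> alpha < 1 / 2 ->
  coincide_with_equivalent_norms
    (ell_space (@poisson R n) alpha) (calL_space (@poisson R n) alpha)
    (ell_norm (@poisson R n) alpha) (calL_norm (@poisson R n) alpha) /\
  coincide_with_equivalent_norms
    (ell_space (@heat R n) alpha) (calL_space (@heat R n) alpha)
    (ell_norm (@heat R n) alpha) (calL_norm (@heat R n) alpha).
Proof.
case: n => // n _ alpha0 alpha2.
have gt1 (b : R) : 0 < b -> 1 < 2 `^ b.
  move=> b0; have := @gt0_ltr_powR R b b0 1 2.
  by rewrite powR1 !nnegrE; apply => //; rewrite ltr1n.
have lam1 := gt1 _ alpha0.
(* This is where $\alpha<1/2$ enters: $2=2^{2\alpha}\cdot 2^{1-2\alpha}$ with the last factor above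
   1. *)
have lam2 : (2 `^ alpha) ^+ 2 < 2.
  have h1 : 1 < 2 `^ (1 - alpha * 2) by apply: gt1; lra.
  have h2 : (2 `^ alpha) ^+ 2 * 2 `^ (1 - alpha * 2) = 2.
    rewrite -powR_mulrn ?powR_ge0// -powRrM -powRD.
      by rewrite addrC subrK powRr1.
    by rewrite pnatr_eq0 implybT.
  by rewrite -[ltRHS]h2 ltr_pMr// exprn_gt0// powR_gt0.
split.
  apply: (dyadic_semigroup_equiv (@dyadic_poisson_kernel R n)) => //.
  (* With [theta] equal to 1/2 the condition is $\lambda<2$, which follows from
     $\lambda\le\lambda^2<2$. *)
  by rewrite mulrC ltr_pdivrMr// mul1r (le_lt_trans _ lam2)// expr2 ler_peMl// ltW.
apply: (dyadic_semigroup_equiv (@dyadic_heat_kernel R n.+1)) => //.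
(* With [theta] equal to $2^{-1/2}$ the product is $\sqrt{\lambda^2/2}$, so the condition is [lam2]
   again. *)
rewrite -[ltRHS]sqrtr1 -[X in _ * X](ger0_norm (powR_ge0 _ _)) -sqrtr_sqr.
by rewrite -sqrtrM ?invr_ge0// ltr_sqrt// mulrC ltr_pdivrMr// mul1r.
Qed.
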